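(* There are infinitely many natural numbers $n$ for which $$\pi(n)=\frac{n}{\left\lfloor \ln n-\frac{1}{2}\right\rfloor},$$ where $\pi(n)$ denotes the number of primes not greater than $n$.
   Context: $\pi(n)$ is the prime counting function (the number of primes $p\le n$), $\ln$ is the natural logarithm, and $\lfloor x\rfloor$ is the greatest integer not exceeding $x$. *)

(* Defs.v *)
From mathcomp Require Import all_boot.
From Stdlib Require Import Reals.

Definition prime_pi (n : nat) : nat := count prime (iota 0 n.+1).

(* floor of a real number: Int_part r = up r - 1 is the greatest integer <= r *)
Definition floorR (r : R) : Z := Int_part r.

(* Main.v *)
(** Put [k = floor (ln n - 1/2)].  Along [n], the quantity [k * pi n - n] drops by at
    most one per step, so if it never vanishes for large [n] it is eventually of constant
    sign: on each block [e^(k+1/2) <= n < e^(k+3/2)], always [pi n < n / k] or always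
    [pi n > n / k].  Since [n / (ln n - 1)] crosses [n / k] in the middle of each block,
    such a one-sided bound forces an oscillation of [pi (e^t) / e^t] of relative size
    [1 / t] and period 1 in [t].  Mertens' theorem gives
    [sum_(p <= N) ln p / p = ln N + O(1)], and as [zeta (1 + 2 pi i) <> 0] the sum twisted
    by [p^(- 2 pi i)] is [O(1)].  Testing against [2 -+ sin (2 pi t)], a one-sided bound
    would change the resulting sum [2 ln N + O(1)] by a multiple of
    [sum_(k <= ln N) 1 / k], which is unbounded. *)

From Stdlib Require Import Reals Lra Lia Classical.
From Coquelicot Require Import Coquelicot.
From HB Require Import structures.
From mathcomp Require Import all_boot zify.
Require Import Defs.
Open Scope R_scope.

(** * Finite sums and Euler summation *)

(** The bias in the $k$-th block is only of order $1/k$ against a block total of 2, so over all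
    blocks it grows like $\ln\ln N$. The relation $\pi(n) \sim n/\ln n$ is too coarse to contradict
    this; what is needed is a test sum known up to $O(1)$, and sums with weight $\ln p/p$ have that
    precision already from Chebyshev's bound. The frequency $2\pi$ matches the unit length of a
    block in $t = \ln n$, and the bias is the integral of $t\sin(2\pi t)$ over $[k+1/2, k+3/2]$,
    which equals $1/(2\pi)$ for every $k$. The twist requires $\zeta(1+iy) \ne 0$ at the single
    point $y = 2\pi$, so a numerical proof that the real part is positive replaces the general
    theorem. Complex numbers are avoided: a free phase [al] in $\cos(y\ln n + al)$ plays the role of
    multiplication by $e^{i\,al}$. *)

HB.instance Definition _ := Monoid.isComLaw.Build R 0 Rplus
  (fun x y z => esym (Rplus_assoc x y z)) Rplus_comm Rplus_0_l.
HB.instance Definition _ := Monoid.isMulLaw.Build R 0 Rmult Rmult_0_l Rmult_0_r.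
HB.instance Definition _ :=
  Monoid.isAddLaw.Build R Rmult Rplus Rmult_plus_distr_r Rmult_plus_distr_l.

Notation "\sum_ ( m <= i < n ) F" := (\big[Rplus/0]_(m <= i < n) F) : R_scope.
Notation "\sum_ ( m <= i < n | P ) F" :=
  (\big[Rplus/0]_(m <= i < n | P%B) F) : R_scope.

Lemma sumR_le (m n : nat) (P : pred nat) (f g : nat -> R) :
  (forall i, (m <= i < n)%N -> P i -> f i <= g i) ->
  \sum_(m <= i < n | P i) f i <= \sum_(m <= i < n | P i) g i.
Proof.
move=> H; rewrite big_nat_cond [X in _ <= X]big_nat_cond.
apply: (big_ind2 (fun x y => x <= y)) => [|a b c d|i /andP[]]; [lra|lra|exact: H].
Qed.

Lemma sumR_ge0 (m n : nat) (P : pred nat) (f : nat -> R) :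
  (forall i, (m <= i < n)%N -> P i -> 0 <= f i) -> 0 <= \sum_(m <= i < n | P i) f i.
Proof.
move=> H; rewrite big_nat_cond.
apply: (big_ind (fun x => 0 <= x)) => [|a b|i /andP[]]; [lra|lra|exact: H].
Qed.

Lemma sumR_abs (m n : nat) (P : pred nat) (f : nat -> R) :
  Rabs (\sum_(m <= i < n | P i) f i) <= \sum_(m <= i < n | P i) Rabs (f i).
Proof.
apply: (big_ind2 (fun x y => Rabs x <= y)) => [|a b c d H1 H2|i _].
- by rewrite Rabs_R0; lra.
- by have := Rabs_triang a c; lra.
- lra.
Qed.

Lemma sumR_sub (m n : nat) (P : pred nat) (f g : nat -> R) :
  \sum_(m <= i < n | P i) f i - \sum_(m <= i < n | P i) g i
  = \sum_(m <= i < n | P i) (f i - g i).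
Proof.
rewrite [RHS](eq_bigr (fun i => f i + (-1) * g i)); last by move=> i _; lra.
by rewrite big_split -big_distrr /=; lra.
Qed.

Lemma sumR_telescope (m n : nat) (f : nat -> R) : (m <= n)%N ->
  \sum_(m <= i < n) (f i.+1 - f i) = f n - f m.
Proof.
elim: n => [|n IH] H.
  by have ->: m = 0%N by [lia]; rewrite big_geq //; lra.
have [H1|H1] := leqP m n; first by rewrite big_nat_recr //= IH //; lra.
by have ->: m = n.+1 by [lia]; rewrite big_geq //; lra.
Qed.

Lemma sumR_const (n : nat) (c : R) : \sum_(1 <= i < n.+1) c = INR n * c.
Proof.
elim: n => [|n IH]; first by rewrite big_geq //=; lra.
by rewrite big_nat_recr //= IH -/(INR n.+1) S_INR; lra.
Qed.

Lemma INR_leq (m n : nat) : (m <= n)%N -> INR m <= INR n.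
Proof. by move=> H; apply: le_INR; lia. Qed.

Lemma INR_ltn (m n : nat) : (m < n)%N -> INR m < INR n.
Proof. by move=> H; apply: lt_INR; lia. Qed.

Lemma INR_ge1 (n : nat) : (0 < n)%N -> 1 <= INR n.
Proof. by move=> H; apply: (INR_leq 1). Qed.

Lemma incr_of_derive (g g1 : R -> R) (a b : R) : a <= b ->
  (forall x, a <= x <= b -> is_derive g x (g1 x)) ->
  (forall x, a <= x <= b -> 0 <= g1 x) -> g a <= g b.
Proof.
move=> ab Hg Hp.
have [c [Hc E]] : exists c, a <= c <= b /\ g b - g a = g1 c * (b - a).
  have := MVT_gen g a b g1; rewrite Rmin_left // Rmax_right //; apply => x Hx.
    by apply: Hg; lra.
  apply/continuity_pt_filterlim/ex_derive_continuous.
  by exists (g1 x); apply: Hg.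
have := Rmult_le_pos _ (b - a) (Hp c Hc); lra.
Qed.

(** Integral estimates below are phrased through primitives; this is $|\int g'| \le \int G'$ in that
    form. *)
Lemma derive_dominated (g g1 G G1 : R -> R) (a b : R) : a <= b ->
  (forall x, a <= x <= b -> is_derive g x (g1 x)) ->
  (forall x, a <= x <= b -> is_derive G x (G1 x)) ->
  (forall x, a <= x <= b -> Rabs (g1 x) <= G1 x) ->
  Rabs (g b - g a) <= G b - G a.
Proof.
move=> ab Hg HG Hl.
have H1 : G a - g a <= G b - g b.
  apply: (incr_of_derive (fun x => G x - g x) (fun x => G1 x - g1 x)) => // x Hx.
    by apply: (is_derive_minus (V := R_NormedModule)); auto.
  by have := Hl x Hx; have := Rle_abs (g1 x); lra.
have H2 : G a + g a <= G b + g b.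
  apply: (incr_of_derive (fun x => G x + g x) (fun x => G1 x + g1 x)) => // x Hx.
    by apply: (is_derive_plus (V := R_NormedModule)); auto.
  by have := Hl x Hx; have := Rle_abs (- g1 x); rewrite Rabs_Ropp; lra.
apply: Rabs_le; lra.
Qed.

Section EulerSummation.
Variables F f f1 T T1 : R -> R.
Hypothesis dF : forall x, 1 <= x -> is_derive F x (f x).
Hypothesis df : forall x, 1 <= x -> is_derive f x (f1 x).
Hypothesis dT : forall x, 1 <= x -> is_derive T x (T1 x).
Hypothesis f1T1 : forall x, 1 <= x -> Rabs (f1 x) <= - T1 x.
Hypothesis T_ge0 : forall x, 1 <= x -> 0 <= T x.

(** Integration by parts: $F(x) - (x-a)f(x)$ has derivative $-(x-a)f'(x)$, which on $[a,a+1]$ is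
    bounded by $|f'| \le -T'$. *)
Lemma euler_step (n : nat) : (0 < n)%N ->
  Rabs (F (INR n.+1) - F (INR n) - f (INR n.+1)) <= T (INR n) - T (INR n.+1).
Proof.
move=> n0; have n1 := INR_ge1 _ n0; rewrite S_INR.
set a := INR n in n1 *.
have -> : F (a + 1) - F a - f (a + 1)
  = (F (a + 1) - (a + 1 - a) * f (a + 1)) - (F a - (a - a) * f a) by lra.
have -> : T a - T (a + 1) = (- T (a + 1)) - (- T a) by lra.
apply: (derive_dominated (fun x => F x - (x - a) * f x) (fun x => - ((x - a) * f1 x))
         (fun x => - T x) (fun x => - T1 x)) => [|x Hx|x Hx|x Hx]; first by lra.
- have H1 := dF x ltac:(lra); have H2 := df x ltac:(lra).
  auto_derive.
    by split; [exists (f x)|split => //; exists (f1 x)].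
  by rewrite (is_derive_unique _ _ _ H1) (is_derive_unique _ _ _ H2); ring.
- by apply: (is_derive_opp (V := R_NormedModule)); apply: dT; lra.
- rewrite Rabs_Ropp Rabs_mult (Rabs_right (x - a)); last by lra.
  have := f1T1 x ltac:(lra); have := Rabs_pos (f1 x) => H3 H4.
  have := Rmult_le_compat_r _ (x - a) 1 H3 ltac:(lra); lra.
Qed.

Lemma euler_range (m n : nat) : (0 < m)%N -> (m <= n)%N ->
  Rabs (\sum_(1 <= i < n.+1) f (INR i) - F (INR n)
        - (\sum_(1 <= i < m.+1) f (INR i) - F (INR m))) <= T (INR m) - T (INR n).
Proof.
move=> m0; elim: n => [|n IH] mn; first by lia.
have [H|H] := leqP m n; last first.
  by have ->: m = n.+1 by [lia]; rewrite Rminus_diag Rabs_R0; lra.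
rewrite big_nat_recr //=.
rewrite -/(INR n.+1); have := IH H; have := euler_step n ltac:(lia).
by move=> /Rabs_le_between H1 /Rabs_le_between H2; apply: Rabs_le; lra.
Qed.

(** By [euler_range] every left end [D n - T n] lies below every right end [D m + T m], so the
    supremum of the left ends is a constant within [T] of every [D n]. No convergence of [T] to 0 is
    involved. *)
Lemma euler_sum : exists Z, forall N, (0 < N)%N ->
  Rabs (\sum_(1 <= n < N.+1) f (INR n) - F (INR N) - Z) <= T (INR N).
Proof.
pose D n := \sum_(1 <= i < n.+1) f (INR i) - F (INR n).
have H m n : (0 < m)%N -> (0 < n)%N -> D n - T (INR n) <= D m + T (INR m).
  move=> m0 n0; have [mn|nm] := leqP m n.
    have := euler_range m n m0 mn; rewrite -/(D m) -/(D n) => /Rabs_le_between.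
    have := T_ge0 _ (INR_ge1 _ n0); lra.
  have := euler_range n m n0 (ltnW nm); rewrite -/(D m) -/(D n) => /Rabs_le_between.
  have := T_ge0 _ (INR_ge1 _ m0); lra.
have [Z [Z1 Z2]] : {Z | is_lub (fun x => exists n, (0 < n)%N /\ x = D n - T (INR n)) Z}.
  apply: completeness.
    by exists (D 1%N + T (INR 1)) => x [n [n0 ->]]; apply: H.
  by exists (D 1%N - T (INR 1)); exists 1%N.
exists Z => N N0; rewrite -/(D N).
have A := Z1 (D N - T (INR N)) (ex_intro _ N (conj N0 erefl)).
have B : Z <= D N + T (INR N) by apply: Z2 => x [n [n0 ->]]; apply: H.
by apply: Rabs_le; lra.
Qed.

End EulerSummation.

(** * Sums of [cos (y * ln n) / n] *)

(** [derive_dominated] is used twice: the Taylor remainder of $f$ is at most $m(x-a)^2/2$, and half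
    of it is the derivative of the trapezoid error at $x$. *)
Lemma trapezoid_step (F f f1 f2 : R -> R) (a m : R) :
  (forall x, a <= x -> is_derive F x (f x)) ->
  (forall x, a <= x -> is_derive f x (f1 x)) ->
  (forall x, a <= x -> is_derive f1 x (f2 x)) ->
  (forall x, a <= x -> Rabs (f2 x) <= m) ->
  Rabs (F (a + 1) - F a - (f a + f (a + 1)) / 2) <= m / 12.
Proof.
move=> dF df df1 f2m.
have H x : a <= x -> Rabs (f x - f a - (x - a) * f1 x) <= m * (x - a) ^ 2 / 2.
  move=> ax.
  have -> : f x - f a - (x - a) * f1 x
    = (f x - (x - a) * f1 x) - (f a - (a - a) * f1 a) by lra.
  have -> : m * (x - a) ^ 2 / 2 = m * (x - a) ^ 2 / 2 - m * (a - a) ^ 2 / 2 by lra.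
  apply: (derive_dominated (fun x => f x - (x - a) * f1 x)
    (fun x => - ((x - a) * f2 x)) (fun x => m * (x - a) ^ 2 / 2)
    (fun x => m * (x - a))) => // t Ht.
  - have H1 := df t ltac:(lra); have H2 := df1 t ltac:(lra).
    auto_derive.
      by split; [exists (f1 t)|split => //; exists (f2 t)].
    by rewrite (is_derive_unique _ _ _ H1) (is_derive_unique _ _ _ H2); ring.
  - by auto_derive => //; field.
  - rewrite Rabs_Ropp Rabs_mult (Rabs_right (t - a)); last by lra.
    by have := Rmult_le_compat_l (t - a) _ _ ltac:(lra) (f2m t ltac:(lra)); lra.
have -> : F (a + 1) - F a - (f a + f (a + 1)) / 2
  = (F (a + 1) - (a + 1 - a) * (f a + f (a + 1)) / 2)
    - (F a - (a - a) * (f a + f a) / 2) by lra.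
have -> : m / 12 = m * (a + 1 - a) ^ 3 / 12 - m * (a - a) ^ 3 / 12 by field.
apply: (derive_dominated (fun x => F x - (x - a) * (f a + f x) / 2)
    (fun x => (f x - f a - (x - a) * f1 x) / 2) (fun x => m * (x - a) ^ 3 / 12)
    (fun x => m * (x - a) ^ 2 / 4)) => [|t Ht|t Ht|t Ht]; first by lra.
- have H1 := dF t ltac:(lra); have H2 := df t ltac:(lra).
  auto_derive.
    by split; [exists (f t)|split => //; exists (f1 t)].
  by rewrite (is_derive_unique _ _ _ H1) (is_derive_unique _ _ _ H2); field.
- by auto_derive => //; field.
- rewrite Rabs_div; last by lra.
  rewrite (Rabs_right 2); last by lra.
  by have := H t ltac:(lra); lra.
Qed.

Lemma Rabs_cos_le1 (x : R) : Rabs (cos x) <= 1.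
Proof. by apply: Rabs_le; have := COS_bound x. Qed.

Lemma Rabs_sin_le1 (x : R) : Rabs (sin x) <= 1.
Proof. by apply: Rabs_le; have := SIN_bound x. Qed.

Lemma Rabs_comb_le (a b u v : R) : Rabs u <= 1 -> Rabs v <= 1 ->
  Rabs (a * u + b * v) <= Rabs a + Rabs b.
Proof.
move=> hu hv; apply: Rle_trans (Rabs_triang _ _) _; rewrite !Rabs_mult.
have := Rmult_le_compat_l _ _ _ (Rabs_pos a) hu.
have := Rmult_le_compat_l _ _ _ (Rabs_pos b) hv; lra.
Qed.

Lemma ln_ge0 (x : R) : 1 <= x -> 0 <= ln x.
Proof. by move=> x1; rewrite -ln_1; apply: ln_le; lra. Qed.

Lemma ln_le_pred (x : R) : 0 < x -> ln x <= x - 1.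
Proof.
move=> x0; have := exp_ineq1_le (ln x); rewrite exp_ln //; lra.
Qed.

Section Oscillation.
Variable y : R.
Hypothesis y_gt0 : 0 < y.

Lemma osc_sum_phase (al : R) : exists Z, forall N, (0 < N)%N ->
  Rabs (\sum_(1 <= n < N.+1) (cos (y * ln (INR n) + al) / INR n)
        - sin (y * ln (INR N) + al) / y - Z) <= (y + 1) / INR N.
Proof.
apply: (euler_sum (fun x => sin (y * ln x + al) / y)
  (fun x => cos (y * ln x + al) / x)
  (fun x => ((- y) * sin (y * ln x + al) + (-1) * cos (y * ln x + al)) / x ^ 2)
  (fun x => (y + 1) / x) (fun x => - (y + 1) / x ^ 2)) => x x1.
- by auto_derive; [lra|field; lra].
- by auto_derive; [lra|field; lra].
- by auto_derive; [lra|field; lra].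
- have X : 0 < x ^ 2 by apply: pow_lt; lra.
  rewrite Rabs_div; last by lra.
  rewrite (Rabs_right (x ^ 2)); last by lra.
  rewrite -Ropp_div Ropp_involutive.
  apply: Rmult_le_compat_r; first by apply/Rlt_le/Rinv_0_lt_compat.
  have := Rabs_comb_le (- y) (-1) _ _ (Rabs_sin_le1 (y * ln x + al)) (Rabs_cos_le1 (y * ln x + al)).
  by rewrite Rabs_Ropp Rabs_Ropp (Rabs_right y) ?(Rabs_right 1); lra.
- by apply: Rdiv_le_0_compat; lra.
Qed.

(** Here $\zeta(1+iy) = Z_1 - iZ_2$, and the constant is the real part of $\zeta(1-iy)e^{i\,al}$.
    The phase is later $y\ln p + al$, so constants and error must be uniform in [al]; hence the
    combination of just two phases, which doubles the error. *)
Lemma osc_sum : exists Z1 Z2, forall (al : R) N, (0 < N)%N ->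
  Rabs (\sum_(1 <= n < N.+1) (cos (y * ln (INR n) + al) / INR n)
        - sin (y * ln (INR N) + al) / y - (Z1 * cos al - Z2 * sin al))
  <= 2 * (y + 1) / INR N.
Proof.
have [Z1 H1] := osc_sum_phase 0; have [Z2 H2] := osc_sum_phase (- (PI / 2)).
exists Z1, Z2 => al N N0; move: (H1 N N0) (H2 N N0) => {H1 H2}.
have C (t : R) : cos (t + - (PI / 2)) = sin t by rewrite cos_sin; congr sin; field.
have S (t : R) : sin (t + - (PI / 2)) = - cos t.
  by rewrite -[cos t]sin_shift -sin_neg; congr sin; lra.
rewrite S Rplus_0_r.
under eq_bigr => n _ do rewrite Rplus_0_r.
under [in X in _ -> X -> _]eq_bigr => n _ do rewrite C.
have -> : \sum_(1 <= n < N.+1) (cos (y * ln (INR n) + al) / INR n)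
  = cos al * \sum_(1 <= n < N.+1) (cos (y * ln (INR n)) / INR n)
    - sin al * \sum_(1 <= n < N.+1) (sin (y * ln (INR n)) / INR n).
  rewrite !big_distrr /= sumR_sub; apply: eq_bigr => n _.
  by rewrite cos_plus; lra.
rewrite sin_plus; set A := \sum_(_ <= _ < _) _; set B := \sum_(_ <= _ < _) _.
move=> H1 H2.
have -> : cos al * A - sin al * B
   - (sin (y * ln (INR N)) * cos al + cos (y * ln (INR N)) * sin al) / y
   - (Z1 * cos al - Z2 * sin al)
  = (A - sin (y * ln (INR N)) / y - Z1) * cos al
    + - (B - - cos (y * ln (INR N)) / y - Z2) * sin al by field; lra.
apply: Rle_trans (Rabs_comb_le _ _ _ _ (Rabs_cos_le1 al) (Rabs_sin_le1 al)) _.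
by rewrite Rabs_Ropp; lra.
Qed.

(** Euler summation with the primitive $\ln x\sin(\cdot)/y + \cos(\cdot)/y^2$; its second term is
    bounded and goes into [C]. *)
Lemma osc_sum_log (al : R) : exists C, forall N, (0 < N)%N ->
  Rabs (\sum_(1 <= n < N.+1) (cos (y * ln (INR n) + al) / INR n * ln (INR n))
        - ln (INR N) * sin (y * ln (INR N) + al) / y) <= C.
Proof.
have [Z H] : exists Z, forall N, (0 < N)%N ->
  Rabs (\sum_(1 <= n < N.+1) (cos (y * ln (INR n) + al) / INR n * ln (INR n))
        - (ln (INR N) * sin (y * ln (INR N) + al) / y + cos (y * ln (INR N) + al) / y ^ 2) - Z)
  <= (y + 1) * (ln (INR N) + 2) / INR N.
  apply: (euler_sum
    (fun x => ln x * sin (y * ln x + al) / y + cos (y * ln x + al) / y ^ 2)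
    (fun x => cos (y * ln x + al) / x * ln x)
    (fun x => ((- (y * ln x)) * sin (y * ln x + al) + (1 - ln x) * cos (y * ln x + al)) / x ^ 2)
    (fun x => (y + 1) * (ln x + 2) / x) (fun x => - ((y + 1) * (1 + ln x)) / x ^ 2)) => x x1.
  - by auto_derive; [lra|field; lra].
  - by auto_derive; [lra|field; lra].
  - by auto_derive; [lra|field; lra].
  - have X : 0 < x ^ 2 by apply: pow_lt; lra.
    rewrite Rabs_div; last by lra.
    rewrite (Rabs_right (x ^ 2)); last by lra.
    rewrite -Ropp_div Ropp_involutive.
    apply: Rmult_le_compat_r; first by apply/Rlt_le/Rinv_0_lt_compat.
    have L := ln_ge0 x x1.
    have := Rabs_comb_le (- (y * ln x)) (1 - ln x) _ _
      (Rabs_sin_le1 (y * ln x + al)) (Rabs_cos_le1 (y * ln x + al)).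
    have yl : 0 <= y * ln x by apply: Rmult_le_pos; lra.
    rewrite Rabs_Ropp (Rabs_right (y * ln x)); last by lra.
    have : Rabs (1 - ln x) <= 1 + ln x by apply: Rabs_le; lra.
    lra.
  - have L := ln_ge0 x x1.
    by apply: Rdiv_le_0_compat; [apply: Rmult_le_pos; lra|lra].
exists ((y + 1) * 2 + / y ^ 2 + Rabs Z) => N N0.
have N1 := INR_ge1 _ N0.
have B1 : (y + 1) * (ln (INR N) + 2) / INR N <= (y + 1) * 2.
  apply: (Rmult_le_reg_r (INR N)); first by lra.
  rewrite /Rdiv Rmult_assoc Rinv_l ?Rmult_1_r; last by lra.
  rewrite Rmult_assoc; apply: Rmult_le_compat_l; first by lra.
  by have := ln_le_pred (INR N) ltac:(lra); lra.
have Y : 0 < y ^ 2 by apply: pow_lt.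
have B2 : Rabs (cos (y * ln (INR N) + al) / y ^ 2) <= / y ^ 2.
  rewrite Rabs_div; last by lra.
  rewrite (Rabs_right (y ^ 2)); last by lra.
  have := Rmult_le_compat_r (/ y ^ 2) _ _ (Rlt_le _ _ (Rinv_0_lt_compat _ Y)) (Rabs_cos_le1 (y * ln (INR N) + al)).
  by rewrite Rmult_1_l.
move: (H N N0) B2 => /Rabs_le_between H1 /Rabs_le_between H2.
have /Rabs_le_between H3 := Rle_refl (Rabs Z).
by apply: Rabs_le; lra.
Qed.

End Oscillation.

Lemma exp_INR_mult (n : nat) (x : R) : exp (INR n * x) = exp x ^ n.
Proof.
elim: n => [|n IH]; first by rewrite Rmult_0_l exp_0.
by rewrite S_INR Rmult_plus_distr_r Rmult_1_l exp_plus IH Rmult_comm.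
Qed.

Lemma ln3_ge1 : 1 <= ln 3.
Proof.
rewrite -{1}(ln_exp 1); apply: ln_le; [exact: exp_pos|exact: exp_le_3].
Qed.

(** The value $7/6$ is the one for which $2\pi(7/6 - 1) = \pi/3$, so that $\cos(2\pi\ln 3) \ge
    1/2$. *)
Lemma ln3_le : ln 3 <= 7 / 6.
Proof.
have E : 7 / 6 = INR 14 * (1 / 12) by rewrite /=; lra.
have : 3 <= exp (7 / 6).
  rewrite E exp_INR_mult.
  have : (13 / 12) ^ 14 <= exp (1 / 12) ^ 14.
    by apply: pow_incr; have := exp_ineq1_le (1 / 12); lra.
  lra.
by move=> H; rewrite -(ln_exp (7 / 6)); apply: ln_le; lra.
Qed.

(* Trapezoidal summation from [n = 4] on: the main part is at least [3/8] and the
   error at most [(y ^ 2 + 3 * y) / 288 <= 88 / 288], for [y = 2 * PI <= 8]. *)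
Lemma osc_sum_re_pos (Z1 : R) :
  (forall N, (0 < N)%N ->
    Rabs (\sum_(1 <= n < N.+1) (cos (2 * PI * ln (INR n)) / INR n)
          - sin (2 * PI * ln (INR N)) / (2 * PI) - Z1) <= 2 * (2 * PI + 1) / INR N) ->
  0 < Z1.
Proof.
move=> HZ; have P4 := PI_4; have P3 : 3 < PI by have := PI2_3_2; lra.
have [y Ey] : {y | y = 2 * PI} by exists (2 * PI).
rewrite -Ey in HZ.
have y8 : 6 <= y <= 8 by lra.
pose f x := cos (y * ln x) / x; pose F x := sin (y * ln x) / y.
pose D N := \sum_(1 <= n < N.+1) f (INR n) - F (INR N) - f (INR N) / 2.
have tr a : 1 <= a -> Rabs (F (a + 1) - F a - (f a + f (a + 1)) / 2) <= (88 / a ^ 3) / 12.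
  move=> a1.
  apply: (trapezoid_step F f (fun x => (- y * sin (y * ln x) - cos (y * ln x)) / x ^ 2)
    (fun x => ((2 - y ^ 2) * cos (y * ln x) + (3 * y) * sin (y * ln x)) / x ^ 3)) => x ax.
  - by rewrite /F /f; auto_derive; [lra|field; lra].
  - by rewrite /f; auto_derive; [lra|field; lra].
  - by auto_derive; [repeat split; try lra; apply: Rgt_not_eq; nra|field; lra].
  - have X : 0 < x ^ 3 by apply: pow_lt; lra.
    have A : 0 < a ^ 3 by apply: pow_lt; lra.
    rewrite Rabs_div; last by lra.
    rewrite (Rabs_right (x ^ 3)); last by lra.
    apply: Rmult_le_compat.
    + exact: Rabs_pos.
    + exact/Rlt_le/Rinv_0_lt_compat.
    + apply: Rle_trans (Rabs_comb_le _ _ _ _ (Rabs_cos_le1 _) (Rabs_sin_le1 _)) _.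
      rewrite (Rabs_left (2 - y ^ 2)); last by nra.
      by rewrite Rabs_right; nra.
    + by apply: Rinv_le_contravar => //; apply: pow_incr; lra.
(* The errors $1/a^3$ are replaced by $1/((a-1)a(a+1))$, which telescopes and sums to $1/24$ from $a
   = 4$ on. *)
have dom N : (4 <= N)%N ->
    D 4%N - 88 / 24 * (/ 12 - / ((INR N - 1) * INR N)) <= D N.
  elim: N => [//|N IH] H.
  have [H4|H4] := leqP 4 N; last first.
    have -> : N = 3%N by lia.
    by rewrite /=; lra.
  have n4 : 4 <= INR N by have := INR_leq _ _ H4; rewrite /=; lra.
  have := tr (INR N) ltac:(lra); have := IH H4; rewrite -S_INR => I1 /Rabs_le_between [I2 I3].
  have -> : D N.+1 = D N - (F (INR N.+1) - F (INR N) - (f (INR N) + f (INR N.+1)) / 2).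
    by rewrite /D big_nat_recr //=; lra.
  rewrite S_INR in I2 I3 *; set a := INR N in n4 I1 I2 I3 *.
  have E : / ((a - 1) * a) - / ((a + 1 - 1) * (a + 1)) = 2 / ((a - 1) * a * (a + 1)).
    by field; lra.
  have L : 2 / a ^ 3 <= 2 / ((a - 1) * a * (a + 1)).
    apply: Rmult_le_compat_l; first by lra.
    apply: Rinv_le_contravar; last by nra.
    by apply: Rmult_lt_0_compat; [apply: Rmult_lt_0_compat|]; lra.
  rewrite /Rdiv in I2 I3 L *; lra.
(* Termwise: $1 - 1/2 + 1/6 - 1/8 - 1/6$. The last term of the sum enters with half its weight, and
   only the cosine at 3 needs a bound better than $-1$. *)
have D4 : 3 / 8 <= D 4%N.
  rewrite /D unlock /= /f /F.
  have -> : 1 + 1 + 1 + 1 = 4 by lra.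
  have -> : 1 + 1 + 1 = 3 by lra.
  have -> : 1 + 1 = 2 by lra.
  rewrite ln_1 Rmult_0_r cos_0.
  have c3 : 1 / 2 <= cos (y * ln 3).
    have -> : cos (y * ln 3) = cos (y * ln 3 - 2 * PI).
      by rewrite -(cos_period (y * ln 3 - 2 * PI) 1) /=; congr cos; lra.
    rewrite -cos_PI3; have := ln3_ge1; have := ln3_le => l1 l2.
    by apply: cos_decr_1; rewrite ?Ey; nra.
  have := COS_bound (y * ln 2); have := COS_bound (y * ln 4).
  have s4 : sin (y * ln 4) / y <= 1 / 6.
    have := SIN_bound (y * ln 4) => s.
    apply: (Rmult_le_reg_r y); first by lra.
    by rewrite /Rdiv Rmult_assoc Rinv_l; lra.
  lra.
(* The margin is $3/8 - 88/288 = 5/72$. At $N = 1000$ the remaining errors are at most $18/1000$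
   from [HZ] and $1/2000$ from half of the last term. *)
have := HZ 1000%N erefl; have := dom 1000%N erefl.
rewrite -/(F (INR 1000)).
set S := INR 1000.
have ES : S = 1000 by rewrite /S INR_IZR_INZ.
have -> : D 1000%N = \sum_(1 <= n < 1001) (cos (y * ln (INR n)) / INR n) - F S - f S / 2
  by [].
rewrite ES.
have i1 : 0 < / ((1000 - 1) * 1000) by apply: Rinv_0_lt_compat; lra.
have : Rabs (f 1000) <= 1 / 1000.
  rewrite /f Rabs_div; last by lra.
  by rewrite (Rabs_right 1000); [have := Rabs_cos_le1 (y * ln 1000)|]; lra.
by move=> /Rabs_le_between h1 h2 /Rabs_le_between h3; lra.
Qed.

(** * Chebyshev's bound and sums over primes *)

Lemma INR_expn (p k : nat) : INR (p ^ k)%N = INR p ^ k.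
Proof.
elim: k => [//|k IH]; rewrite expnS mult_INR IH //.
Qed.

Lemma INR_gt0 (n : nat) : (0 < n)%N -> 0 < INR n.
Proof. by move=> /INR_ge1; lra. Qed.

Lemma sumR_dvdn (d N : nat) (h : nat -> R) : (0 < d)%N ->
  \sum_(1 <= n < N.+1 | d %| n) h n = \sum_(1 <= m < (N %/ d).+1) h (d * m)%N.
Proof.
move=> d0; elim: N => [|N IH]; first by rewrite div0n !big_geq.
rewrite big_mkcond big_nat_recr //= -big_mkcond IH divnS //.
case: ifP => [H|_] /=; last by rewrite add0n Rplus_0_r.
rewrite add1n [RHS]big_nat_recr //=.
suff -> : (d * (N %/ d).+1)%N = N.+1 by [].
by have := divnS N d0; rewrite H add1n => <-; rewrite mulnC divnK.
Qed.

Lemma sumR_ltn_const (L N : nat) (c : R) : (L <= N)%N ->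
  \sum_(1 <= k < N.+1 | (k <= L)%N) c = INR L * c.
Proof.
move=> LN; rewrite (big_cat_nat (n := L.+1)) //=.
rewrite [X in _ + X]big_nat_cond [X in _ + X]big_pred0; last by move=> i; lia.
rewrite -sumR_const Rplus_0_r big_nat_cond [RHS]big_nat_cond.
by apply: eq_bigl => i; lia.
Qed.

Lemma ln_prod (r : seq nat) (P : pred nat) (F : nat -> nat) :
  (forall i, P i -> (0 < F i)%N) ->
  ln (INR (\prod_(i <- r | P i) F i)%N) = \big[Rplus/0]_(i <- r | P i) ln (INR (F i)).
Proof.
move=> HF.
suff [] : (0 < \prod_(i <- r | P i) F i)%N /\
  ln (INR (\prod_(i <- r | P i) F i)%N) = \big[Rplus/0]_(i <- r | P i) ln (INR (F i)) by [].
apply: (big_rec2 (fun a b => (0 < a)%N /\ ln (INR a) = b)) => [|i a b Pi [a0 <-]].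
  by rewrite ln_1.
split; first by rewrite muln_gt0 HF.
by rewrite mult_INR ln_mult //; apply: INR_gt0 => //; apply: HF.
Qed.

(** This is $\ln = \Lambda * 1$. The common cutoff [M] makes the ranges independent of [n], so that
    sums can be exchanged, and lets [theta_double] compare [n] and [2n] term by term. *)
Lemma ln_INR_primes (n M : nat) : (0 < n)%N -> (n <= M)%N ->
  ln (INR n) = \sum_(1 <= p < M.+1 | prime p)
                 \sum_(1 <= k < M.+1 | (p ^ k %| n)%N) ln (INR p).
Proof.
move=> n0 nM.
have E : n = (\prod_(1 <= p < M.+1 | prime p) p ^ logn p n)%N.
  rewrite -[LHS](partnT n0) (widen_partn _ nM) big_ltn_cond //= lognE /= mul1n.
  rewrite big_mkcond [RHS]big_mkcond; apply: eq_bigr => p _ /=.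
  by case: ifP => // H; rewrite lognE H.
rewrite {1}E ln_prod; last by move=> p pp; rewrite expn_gt0 prime_gt0.
apply: eq_bigr => p pp.
rewrite (eq_bigl (fun k => k <= logn p n)%N); last by move=> k; rewrite pfactor_dvdn.
rewrite sumR_ltn_const; last by apply: leq_trans nM; apply/ltnW/ltn_logl.
by rewrite INR_expn ln_pow //; apply/INR_gt0/prime_gt0.
Qed.

Lemma sum_mul_ln_primes (h : nat -> R) (N M : nat) : (N <= M)%N ->
  \sum_(1 <= n < N.+1) (h n * ln (INR n)) =
  \sum_(1 <= p < M.+1 | prime p) (ln (INR p) *
    \sum_(1 <= k < M.+1) \sum_(1 <= m < (N %/ p ^ k).+1) h (p ^ k * m)%N).
Proof.
move=> NM.
transitivity (\sum_(1 <= n < N.+1) \sum_(1 <= p < M.+1 | prime p)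
   \sum_(1 <= k < M.+1) if (p ^ k %| n)%N then h n * ln (INR p) else 0).
  rewrite big_nat_cond [RHS]big_nat_cond; apply: eq_bigr => n Hn.
  rewrite (ln_INR_primes n M); try lia.
  rewrite big_distrr; apply: eq_bigr => p _.
  by rewrite big_distrr -big_mkcond.
rewrite exchange_big; apply: eq_bigr => p pp.
rewrite exchange_big big_distrr; apply: eq_bigr => k _.
rewrite -big_mkcond sumR_dvdn ?expn_gt0 ?prime_gt0 // big_distrr.
by apply: eq_bigr => m _; rewrite /= Rmult_comm.
Qed.

Lemma ln_succ_le (x : R) : 0 < x -> ln (x + 1) <= ln x + / x.
Proof.
move=> x0; have i0 := Rinv_0_lt_compat x x0.
have -> : x + 1 = x * (1 + / x) by field; lra.
rewrite ln_mult; [|lra|lra].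
by have := ln_le_pred (1 + / x) ltac:(lra); lra.
Qed.

Lemma sum_ln_bounds (N : nat) : (0 < N)%N ->
  INR N * ln (INR N) - INR N <= \sum_(1 <= n < N.+1) ln (INR n) <= INR N * ln (INR N).
Proof.
elim: N => [//|[|N] IH] _; first by rewrite big_nat1 /= ln_1; lra.
rewrite big_nat_recr //= -/(INR N.+2).
move: (IH erefl) => {IH}; rewrite (S_INR N.+1).
set S := \sum_(1 <= i < N.+2) _; move: S => S.
have : 1 <= INR N.+1 by apply: INR_ge1.
set a := INR N.+1; move: a => a a1 H.
have L := ln_succ_le a ltac:(lra).
have L2 : ln a <= ln (a + 1) by apply: ln_le; lra.
have := Rmult_le_compat_l a _ _ ltac:(lra) L.
rewrite Rmult_plus_distr_l Rinv_r; last by lra.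
have := Rmult_le_compat_l a _ _ ltac:(lra) L2; lra.
Qed.

Lemma sum_ln_primes (N M : nat) : (N <= M)%N ->
  \sum_(1 <= n < N.+1) ln (INR n) =
  \sum_(1 <= p < M.+1 | prime p) (ln (INR p) *
    \sum_(1 <= k < M.+1) INR (N %/ p ^ k)).
Proof.
move=> NM.
transitivity (\sum_(1 <= n < N.+1) (1 * ln (INR n))).
  by apply: eq_bigr => n _; rewrite Rmult_1_l.
rewrite (sum_mul_ln_primes (fun=> 1) N M) //; apply: eq_bigr => p _; congr (_ * _).
by apply: eq_bigr => k _; rewrite sumR_const Rmult_1_r.
Qed.

Lemma ln_prime_ge0 (p : nat) : prime p -> 0 <= ln (INR p).
Proof. by move=> /prime_gt0 p0; apply/ln_ge0/INR_ge1. Qed.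

(* [ln ((2n)! / (n!)^2)] counts each prime of [(n, 2n]] with weight at least one. *)
Lemma theta_double (n : nat) : (0 < n)%N ->
  \sum_(1 <= p < n.*2.+1 | prime p) ln (INR p)
  <= \sum_(1 <= p < n.+1 | prime p) ln (INR p) + 4 * INR n.
Proof.
move=> n0; have n1 := INR_ge1 n n0.
suff H : \sum_(n.+1 <= p < n.*2.+1 | prime p) ln (INR p) <= 4 * INR n.
  by rewrite (big_cat_nat (n := n.+1)) //=; [lra|lia].
have E2 := sum_ln_primes n.*2 n.*2 (leqnn _).
have E1 := sum_ln_primes n n.*2 ltac:(lia).
have [_ B2] := sum_ln_bounds n.*2 ltac:(lia); have [B1 _] := sum_ln_bounds n n0.
have D : INR n.*2 = 2 * INR n by rewrite -addnn plus_INR; lra.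
(* The crude bounds on $\ln n!$ give $2n\ln 2 + 2n$, and $\ln 2 \le 1$. *)
have B : \sum_(1 <= i < n.*2.+1) ln (INR i) - 2 * \sum_(1 <= i < n.+1) ln (INR i) <= 4 * INR n.
  have l2 : ln 2 <= 1 by have := ln_le_pred 2; lra.
  rewrite D ln_mult in B2; try lra.
  have := Rmult_le_compat_l (INR n) _ _ ltac:(lra) l2; lra.
apply: Rle_trans B; rewrite E1 E2 big_distrr /= sumR_sub.
rewrite [X in _ <= X](big_cat_nat (n := n.+1)) //=; last by lia.
have term p : prime p ->
  ln (INR p) * \sum_(1 <= k < n.*2.+1) INR (n.*2 %/ p ^ k)
    - 2 * (ln (INR p) * \sum_(1 <= k < n.*2.+1) INR (n %/ p ^ k))
  = ln (INR p) * \sum_(1 <= k < n.*2.+1) (INR (n.*2 %/ p ^ k) - 2 * INR (n %/ p ^ k)).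
  by move=> _; rewrite -sumR_sub -big_distrr /=; ring.
have pos p k : prime p -> 0 <= INR (n.*2 %/ p ^ k) - 2 * INR (n %/ p ^ k).
  move=> pp; suff : 2 * INR (n %/ p ^ k) <= INR (n.*2 %/ p ^ k) by lra.
  have -> : 2 = INR 2 by []; rewrite -mult_INR; apply: INR_leq.
  rewrite leq_divRL ?expn_gt0 ?prime_gt0 //.
  by have := leq_trunc_div n (p ^ k); nia.
have : 0 <= \sum_(1 <= p < n.+1 | prime p)
  (ln (INR p) * \sum_(1 <= k < n.*2.+1) INR (n.*2 %/ p ^ k)
    - 2 * (ln (INR p) * \sum_(1 <= k < n.*2.+1) INR (n %/ p ^ k))).
  apply: sumR_ge0 => p _ pp; rewrite term //.
  by apply: Rmult_le_pos; [exact: ln_prime_ge0|apply: sumR_ge0 => k _ _; exact: pos].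
have : \sum_(n.+1 <= p < n.*2.+1 | prime p) ln (INR p)
  <= \sum_(n.+1 <= p < n.*2.+1 | prime p)
  (ln (INR p) * \sum_(1 <= k < n.*2.+1) INR (n.*2 %/ p ^ k)
    - 2 * (ln (INR p) * \sum_(1 <= k < n.*2.+1) INR (n %/ p ^ k))).
  apply: sumR_le => p Hp pp; rewrite term //.
  rewrite -{1}[ln (INR p)]Rmult_1_r; apply: Rmult_le_compat_l; first exact: ln_prime_ge0.
  rewrite big_ltn; last by lia.
  rewrite expn1 (divn_small (m := n)); last by lia.
  have -> : (n.*2 %/ p = 1)%N.
    by apply/eqP; rewrite eqn_leq leq_divRL ?prime_gt0 // -ltnS ltn_divLR ?prime_gt0 //; lia.
  have : 0 <= \sum_(2 <= k < n.*2.+1) (INR (n.*2 %/ p ^ k) - 2 * INR (n %/ p ^ k)).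
    by apply: sumR_ge0 => k _ _; exact: pos.
  rewrite /=; lra.
lra.
Qed.

Lemma theta_le (N : nat) : \sum_(1 <= p < N.+1 | prime p) ln (INR p) <= 16 * INR N.
Proof.
elim/ltn_ind: N => N IH.
have [N0|N0] := posnP N; first by rewrite N0 big_geq //=; lra.
have [N1|N1] := leqP N 1.
  have -> : N = 1%N by lia.
  by rewrite big_mkcond big_nat1 /=; lra.
have h0 : (0 < N./2)%N by lia.
have := IH N./2 ltac:(lia); have := theta_double N./2 h0; have h1 := INR_ge1 _ h0.
have EN := odd_double_half N; set m := N./2 in h0 h1 EN *; clearbody m.
have D : INR m.*2 = 2 * INR m by rewrite -addnn plus_INR; lra.
move: EN; case: (odd N) => /= <- H1 H2; last by rewrite add0n D; lra.
rewrite add1n big_mkcond big_nat_recr //= -big_mkcond -/(INR (m.*2).+1) S_INR D /=.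
have : ln (2 * INR m + 1) <= 2 * INR m.
  by have := ln_le_pred (2 * INR m + 1) ltac:(lra); lra.
case: ifP => _; lra.
Qed.

Lemma geometric_tail (p M : nat) : (1 < p)%N ->
  \sum_(2 <= k < M.+1) / INR (p ^ k)%N <= 2 / INR p ^ 2.
Proof.
move=> p1; have p2 := INR_leq _ _ p1.
have p2' : 2 <= INR p by move: p2 => /=; lra.
set q := / INR p; have q0 : 0 < q by apply: Rinv_0_lt_compat; lra.
have q1 : q <= / 2 by apply: Rinv_le_contravar; lra.
have -> : 2 / INR p ^ 2 = 2 * q ^ 2 by rewrite /q; field; lra.
have [M1|M1] := leqP M 1.
  by rewrite big_geq //; have := pow_lt _ 2 q0; lra.
suff : \sum_(2 <= k < M.+1) / INR (p ^ k)%N <= 2 * q ^ 2 - 2 * q ^ M.+1.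
  by have := pow_lt _ M.+1 q0; lra.
elim: M M1 => [//|M IH] M1.
have E : / INR (p ^ M.+1)%N = q ^ M.+1 by rewrite INR_expn pow_inv.
have P := pow_lt _ M.+1 q0.
have Q : q ^ M.+2 <= / 2 * q ^ M.+1 by exact: Rmult_le_compat_r (Rlt_le _ _ P) q1.
have [H|H] := leqP M 1.
  have M' : M = 1%N by lia.
  by rewrite M' in E P Q *; rewrite big_nat1 E; lra.
rewrite big_nat_recr ?E; last by lia.
move: (q ^ M.+2) (q ^ M.+1) P Q (IH H) => u v P Q /=; lra.
Qed.

(** The induction carries the majorant $(\ln x + 2)/x$, whose decrease from $a$ to $a+1$ is at least
    $\ln(a+1)/(a+1)^2$ and whose value at 1 is 2. *)
Lemma sum_ln_sqr (M : nat) : \sum_(2 <= n < M.+1) (ln (INR n) / INR n ^ 2) <= 2.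
Proof.
have [M1|M1] := leqP M 1; first by rewrite big_geq //; lra.
have M0 := INR_gt0 M ltac:(lia).
suff : \sum_(2 <= n < M.+1) (ln (INR n) / INR n ^ 2) <= 2 - (ln (INR M) + 2) / INR M.
  have := ln_ge0 (INR M) (INR_ge1 M ltac:(lia)) => L.
  have : 0 <= (ln (INR M) + 2) / INR M by apply: Rdiv_le_0_compat; lra.
  lra.
elim: M M1 {M0} => [//|M IH] M1.
have [H|H] := leqP M 0; first by lia.
have a1 := INR_ge1 M H.
have key : ln (INR M.+1) / INR M.+1 ^ 2
    <= (ln (INR M) + 2) / INR M - (ln (INR M.+1) + 2) / INR M.+1.
  rewrite S_INR; set a := INR M in a1 *.
  have L := ln_succ_le a ltac:(lra).
  have l0 : 0 <= ln (a + 1) by apply: ln_ge0; lra.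
  have i0 : 0 < / a by apply: Rinv_0_lt_compat; lra.
  apply: Rle_trans (_ : (ln (a + 1) - / a + 2) / a - (ln (a + 1) + 2) / (a + 1) <= _); last first.
    suff : (ln (a + 1) - / a + 2) / a <= (ln a + 2) / a by lra.
    by apply: Rmult_le_compat_r; lra.
  have -> : (ln (a + 1) - / a + 2) / a - (ln (a + 1) + 2) / (a + 1)
    = ln (a + 1) / (a + 1) ^ 2 + (ln (a + 1) / (a * (a + 1) ^ 2) + (a - 1) / (a ^ 2 * (a + 1))).
    by field; lra.
  have : 0 <= ln (a + 1) / (a * (a + 1) ^ 2).
    by apply: Rdiv_le_0_compat => //; apply: Rmult_lt_0_compat; [|apply: pow_lt]; lra.
  have : 0 <= (a - 1) / (a ^ 2 * (a + 1)).
    by apply: Rdiv_le_0_compat; [|apply: Rmult_lt_0_compat; [apply: pow_lt|]]; lra.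
  lra.
have [H1|H1] := leqP M 1.
  have M' : M = 1%N by lia.
  rewrite M' in key *; rewrite big_nat1; rewrite [INR 1]/= ln_1 in key; lra.
rewrite big_nat_recr //.
move: (ln (INR M.+1) / INR M.+1 ^ 2) ((ln (INR M.+1) + 2) / INR M.+1) key (IH H1).
move=> u v /=; lra.
Qed.

Lemma prime_powers_tail (M : nat) :
  \sum_(1 <= p < M.+1 | prime p) (ln (INR p) * \sum_(2 <= k < M.+1) / INR (p ^ k)%N) <= 4.
Proof.
apply: Rle_trans (_ : \sum_(1 <= p < M.+1 | prime p) (2 * (ln (INR p) / INR p ^ 2)) <= _).
  apply: sumR_le => p _ pp.
  have := Rmult_le_compat_l _ _ _ (ln_prime_ge0 p pp) (geometric_tail p M (prime_gt1 pp)).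
  by rewrite /Rdiv; lra.
rewrite -big_distrr.
suff : \sum_(1 <= p < M.+1 | prime p) (ln (INR p) / INR p ^ 2) <= 2 by rewrite /=; lra.
apply: Rle_trans (sum_ln_sqr M).
case: M => [|M]; first by rewrite !big_geq //; lra.
rewrite big_mkcond big_ltn //= Rplus_0_l.
apply: sumR_le => p Hp _.
have : 0 <= ln (INR p) / INR p ^ 2.
  apply: Rdiv_le_0_compat; first by apply/ln_ge0/INR_ge1; lia.
  by apply/pow_lt/INR_gt0; lia.
by case: ifP => _ //=; lra.
Qed.

(** * Mertens' theorem and its twisted form *)

Lemma INR_divn_bounds (N d : nat) : (0 < d)%N ->
  INR N / INR d - 1 <= INR (N %/ d) <= INR N / INR d.
Proof.
move=> d0; have D := INR_gt0 d d0.
have H1 : INR (N %/ d) * INR d <= INR N by rewrite -mult_INR; apply/INR_leq/leq_trunc_div.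
have H2 : INR N < (INR (N %/ d) + 1) * INR d.
  by rewrite -S_INR -mult_INR; apply/INR_ltn/ltn_ceil.
split.
  suff : INR N / INR d <= INR (N %/ d) + 1 by lra.
  by apply/Rle_div_l => //; lra.
by apply/Rle_div_r => //; lra.
Qed.

(** Compare $\ln N! = N\ln N + O(N)$ with its expansion over primes: removing the floors costs at
    most $\theta(N) \le 16N$, and higher prime powers contribute at most $4N$. *)
Lemma mertens_first : exists C, forall N, (0 < N)%N ->
  Rabs (\sum_(1 <= p < N.+1 | prime p) (ln (INR p) / INR p) - ln (INR N)) <= C.
Proof.
exists 16 => N N0; have n0 := INR_gt0 N N0.
set P := \sum_(_ <= _ < _ | _) _.
have [B1 B2] := sum_ln_bounds N N0; rewrite (sum_ln_primes N N (leqnn N)) in B1 B2.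
set A := \sum_(_ <= _ < _ | _) _ in B1 B2.
have U : A <= INR N * P + 4 * INR N.
  have T := Rmult_le_compat_l _ _ _ (Rlt_le _ _ n0) (prime_powers_tail N).
  rewrite Rmult_comm (Rmult_comm 4).
  apply: Rle_trans (Rplus_le_compat_l _ _ _ T).
  rewrite Rmult_comm !big_distrr -big_split /A.
  apply: sumR_le => p Hp pp.
  rewrite /= big_ltn; last by lia.
  have l0 := ln_prime_ge0 p pp.
  have -> : INR N * (ln (INR p) / INR p) + INR N * (ln (INR p) * \sum_(2 <= k < N.+1) / INR (p ^ k)%N)
     = ln (INR p) * (INR N / INR p + \sum_(2 <= k < N.+1) (INR N * / INR (p ^ k)%N)).
    by rewrite -big_distrr /= /Rdiv; ring.
  apply: Rmult_le_compat_l => //; apply: Rplus_le_compat.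
    by rewrite expn1; have [] := INR_divn_bounds N p (prime_gt0 pp).
  apply: sumR_le => k _ _.
  by have [] := INR_divn_bounds N (p ^ k)%N ltac:(rewrite expn_gt0 prime_gt0).
have L : INR N * P - 16 * INR N <= A.
  have T := theta_le N.
  apply: Rle_trans (_ : INR N * P - \sum_(1 <= p < N.+1 | prime p) ln (INR p) <= _); first by lra.
  rewrite big_distrr sumR_sub; apply: sumR_le => p Hp pp.
  have l0 := ln_prime_ge0 p pp.
  have [H _] := INR_divn_bounds N p (prime_gt0 pp).
  rewrite big_ltn; last by lia.
  have : 0 <= \sum_(2 <= k < N.+1) INR (N %/ p ^ k) by apply: sumR_ge0 => k _ _; apply: pos_INR.
  rewrite expn1 /= => S0.
  have := Rmult_le_compat_l (ln (INR p)) _ _ l0 (_ : _ <= INR (N %/ p) + \sum_(2 <= k < N.+1) INR (N %/ p ^ k)).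
  move=> /(_ (INR N / INR p - 1)); rewrite /Rdiv; lra.
apply: Rabs_le; split; apply: (Rmult_le_reg_l (INR N)) => //; lra.
Qed.

Lemma ln_divn_bounds (N d : nat) : (0 < d)%N -> (d <= N)%N ->
  Rabs (ln (INR d) + ln (INR (N %/ d)) - ln (INR N)) <= / INR (N %/ d).
Proof.
move=> d0 dN; have D := INR_gt0 d d0.
have z0 : (0 < N %/ d)%N by rewrite divn_gt0.
have Z := INR_gt0 _ z0; have N0 : 0 < INR N by apply: INR_gt0; lia.
rewrite -ln_mult //.
have H1 : INR d * INR (N %/ d) <= INR N.
  by rewrite Rmult_comm -mult_INR; apply/INR_leq/leq_trunc_div.
have H2 : INR N <= INR d * (INR (N %/ d) + 1).
  by rewrite -S_INR Rmult_comm -mult_INR; apply/INR_leq/ltnW/ltn_ceil.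
have L1 := ln_le _ _ (Rmult_lt_0_compat _ _ D Z) H1.
have L2 := ln_le _ _ N0 H2.
rewrite ln_mult in L2; [|lra|lra].
rewrite ln_mult // in L1 *.
have := ln_succ_le (INR (N %/ d)) Z; have := Rinv_0_lt_compat _ Z.
by move=> ? ?; apply: Rabs_le; lra.
Qed.

Lemma sin_lipschitz (a b : R) : Rabs (sin a - sin b) <= Rabs (a - b).
Proof.
have := bounded_variation sin cos 1 b a; rewrite Rmult_1_l; apply => t _.
by split; [exact: is_derive_sin|exact: Rabs_cos_le1].
Qed.

Section PrimeOscillation.
Variables y Z1 Z2 : R.
Hypothesis y_gt0 : 0 < y.
Hypothesis osc : forall (al : R) N, (0 < N)%N ->
  Rabs (\sum_(1 <= n < N.+1) (cos (y * ln (INR n) + al) / INR n)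
        - sin (y * ln (INR N) + al) / y - (Z1 * cos al - Z2 * sin al))
  <= 2 * (y + 1) / INR N.

Let bound := / y + (Rabs Z1 + Rabs Z2) + 2 * (y + 1).

Lemma osc_bounded (al : R) (N : nat) :
  Rabs (\sum_(1 <= n < N.+1) (cos (y * ln (INR n) + al) / INR n)) <= bound.
Proof.
have y0 := Rinv_0_lt_compat _ y_gt0; have z1 := Rabs_pos Z1; have z2 := Rabs_pos Z2.
have [N0|N0] := posnP N.
  by rewrite N0 big_geq // Rabs_R0 /bound; lra.
have B : 2 * (y + 1) / INR N <= 2 * (y + 1).
  have n1 := INR_ge1 N N0.
  by apply/Rle_div_l; [lra|]; have := Rmult_le_compat_l (2 * (y + 1)) _ _ ltac:(lra) n1; lra.
have S : Rabs (sin (y * ln (INR N) + al) / y) <= / y.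
  rewrite Rabs_mult (Rabs_right (/ y)); last by lra.
  have := Rmult_le_compat_r (/ y) _ _ (Rlt_le _ _ y0) (Rabs_sin_le1 (y * ln (INR N) + al)); lra.
have Z : Rabs (Z1 * cos al - Z2 * sin al) <= Rabs Z1 + Rabs Z2.
  have := Rabs_comb_le Z1 (- Z2) _ _ (Rabs_cos_le1 al) (Rabs_sin_le1 al).
  by rewrite Rabs_Ropp Ropp_mult_distr_l_reverse.
have := osc al N N0 => /Rabs_le_between; move: S Z => /Rabs_le_between S /Rabs_le_between Z H.
by apply: Rabs_le; rewrite /bound; lra.
Qed.

Let h al (n : nat) := cos (y * ln (INR n) + al) / INR n.

Lemma osc_multiples (al : R) (d z : nat) : (0 < d)%N ->
  \sum_(1 <= m < z.+1) h al (d * m)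
  = / INR d * \sum_(1 <= m < z.+1) (cos (y * ln (INR m) + (y * ln (INR d) + al)) / INR m).
Proof.
move=> d0; have D := INR_gt0 d d0.
rewrite big_distrr big_nat_cond [RHS]big_nat_cond; apply: eq_bigr => m Hm /=.
have M := INR_gt0 m ltac:(lia).
rewrite /h mult_INR ln_mult // Rmult_plus_distr_l.
rewrite (Rplus_comm (y * ln (INR d))) Rplus_assoc.
by field; lra.
Qed.

(** Expand $\sum h(n)\ln n$ over primes. The sum over multiples of $p$ has an oscillating term of
    phase $y\ln(N/p) + y\ln p + al = y\ln N + al$, the same for every $p$. By Mertens these terms
    add up to $\ln N\sin(y\ln N + al)/y + O(1)$, the main term of [osc_sum_log]. What survives is
    the twisted sum times the constant of [osc_sum]. *)
Lemma prime_osc (al : R) : exists C, forall N, (0 < N)%N ->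
  Rabs (\sum_(1 <= p < N.+1 | prime p) (ln (INR p) / INR p *
     (Z1 * cos (y * ln (INR p) + al) - Z2 * sin (y * ln (INR p) + al)))) <= C.
Proof.
have [C0 HC0] := mertens_first; have [C1 HC1] := osc_sum_log y y_gt0 al.
exists (C1 + C0 / y + 4 * bound + 32 * (2 * (y + 1) + 1)) => N N0.
have n0 := INR_gt0 N N0; have y0 := Rinv_0_lt_compat _ y_gt0.
have := HC1 N N0.
rewrite (sum_mul_ln_primes (h al) N N (leqnn N)).
set E := \sum_(1 <= p < N.+1 | prime p) (ln (INR p) / INR p * _).
set A := \sum_(1 <= p < N.+1 | prime p) _.
set s := sin (y * ln (INR N) + al); move=> H1.
set P := \sum_(1 <= p < N.+1 | prime p) (ln (INR p) / INR p).
have HP : Rabs (P - ln (INR N)) <= C0 by exact: HC0.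
pose A1 := \sum_(1 <= p < N.+1 | prime p) (ln (INR p) * \sum_(1 <= m < (N %/ p).+1) h al (p * m)).
(* Proper prime powers: each inner sum is at most [bound] divided by $p^k$. *)
have B2 : Rabs (A - A1) <= 4 * bound.
  have b0 : 0 <= bound.
    by have := osc_bounded 0 0; have := Rabs_pos (\sum_(1 <= n < 1) (cos (y * ln (INR n) + 0) / INR n)); lra.
  apply: Rle_trans (_ : bound * \sum_(1 <= p < N.+1 | prime p) (ln (INR p) * \sum_(2 <= k < N.+1) / INR (p ^ k)%N) <= _); last first.
    by have := Rmult_le_compat_l _ _ _ b0 (prime_powers_tail N); lra.
  rewrite /A /A1 sumR_sub; apply: Rle_trans (sumR_abs _ _ _ _) _.
  rewrite big_distrr; apply: sumR_le => p Hp pp /=.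
  rewrite big_ltn; last by lia.
  rewrite expn1.
  set u := \sum_(1 <= m < (N %/ p).+1) h al (p * m).
  set v := \sum_(2 <= k < N.+1) _.
  have -> : ln (INR p) * (u + v) - ln (INR p) * u = ln (INR p) * v by ring.
  have l0 := ln_prime_ge0 p pp.
  rewrite Rabs_mult (Rabs_right (ln (INR p))); last by lra.
  rewrite -Rmult_assoc (Rmult_comm bound) Rmult_assoc; apply: Rmult_le_compat_l => //.
  rewrite big_distrr; apply: Rle_trans (sumR_abs _ _ _ _) _.
  apply: sumR_le => k _ _ /=.
  have pk : (0 < p ^ k)%N by rewrite expn_gt0 prime_gt0.
  have i0 := Rinv_0_lt_compat _ (INR_gt0 _ pk).
  rewrite osc_multiples // Rabs_mult (Rabs_right (/ INR (p ^ k)%N)); last by lra.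
  by rewrite (Rmult_comm bound); apply: Rmult_le_compat_l; [lra|exact: osc_bounded].
(* For each prime the error, from [osc] and from the floor in $\lfloor N/p\rfloor$, is a multiple of
   $\ln p/N$; Chebyshev's bound makes the total $O(1)$. *)
have B3 : Rabs (A1 - (s / y * P + E)) <= 32 * (2 * (y + 1) + 1).
  have -> : s / y * P + E = \sum_(1 <= p < N.+1 | prime p) (ln (INR p) * (/ INR p *
     (s / y + (Z1 * cos (y * ln (INR p) + al) - Z2 * sin (y * ln (INR p) + al))))).
    rewrite big_distrr -big_split; apply: eq_bigr => p _ /=; rewrite /Rdiv; ring.
  rewrite /A1 sumR_sub; apply: Rle_trans (sumR_abs _ _ _ _) _.
  apply: Rle_trans (_ : (2 * (2 * (y + 1) + 1) / INR N) * \sum_(1 <= p < N.+1 | prime p) ln (INR p) <= _); last first.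
    have c0 : 0 <= 2 * (2 * (y + 1) + 1) / INR N by apply: Rdiv_le_0_compat; lra.
    apply: Rle_trans (Rmult_le_compat_l _ _ _ c0 (theta_le N)) _.
    by apply: Req_le; field; lra.
  rewrite big_distrr; apply: sumR_le => p Hp pp.
  have l0 := ln_prime_ge0 p pp; have p0 := INR_gt0 p (prime_gt0 pp).
  have z0 : (0 < N %/ p)%N by rewrite divn_gt0 ?prime_gt0 //; lia.
  rewrite osc_multiples ?prime_gt0 //.
  rewrite -Rmult_minus_distr_l Rabs_mult (Rabs_right (ln (INR p))); last by lra.
  rewrite /= [X in _ <= X]Rmult_comm; apply: Rmult_le_compat_l => //.
  rewrite -Rmult_minus_distr_l Rabs_mult (Rabs_right (/ INR p)); last first.
    by have := Rinv_0_lt_compat _ p0; lra.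
  apply: (Rmult_le_reg_l (INR p)) => //; rewrite -Rmult_assoc Rinv_r ?Rmult_1_l; last by lra.
  have := osc (y * ln (INR p) + al) _ z0.
  set be := y * ln (INR p) + al.
  set S := \sum_(_ <= _ < _) _; set z := (N %/ p)%N in z0 S *; move=> H.
  have sl : Rabs (sin (y * ln (INR z) + be) / y - s / y) <= / INR z.
    have -> : sin (y * ln (INR z) + be) / y - s / y = (sin (y * ln (INR z) + be) - s) / y by field; lra.
    rewrite Rabs_div; last by lra.
    rewrite (Rabs_right y); last by lra.
    apply/Rle_div_l => //; apply: Rle_trans (sin_lipschitz _ _) _.
    have -> : y * ln (INR z) + be - (y * ln (INR N) + al) = y * (ln (INR p) + ln (INR z) - ln (INR N)).
      by rewrite /be; ring.
    rewrite Rabs_mult (Rabs_right y) ?(Rmult_comm _ y); last by lra.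
    by apply: Rmult_le_compat_l; [lra|apply: ln_divn_bounds; [exact: prime_gt0|lia]].
  (* Since $z \ge 1$, $N/p \le z + 1 \le 2z$. *)
  have iz : / INR z <= 2 * INR p / INR N.
    have zz := INR_gt0 _ z0; have z1 := INR_ge1 _ z0.
    have [q _] := INR_divn_bounds N p (prime_gt0 pp); rewrite -/z in q.
    have q2 : INR N <= 2 * INR p * INR z.
      suff : INR N / INR p <= 2 * INR z by move=> /Rle_div_l; lra.
      lra.
    apply/Rle_div_r => //; apply: (Rmult_le_reg_r (INR z)) => //.
    have -> : / INR z * INR N * INR z = INR N by field; lra.
    lra.
  have -> : INR p * (2 * (2 * (y + 1) + 1) / INR N) = (2 * (y + 1) + 1) * (2 * INR p / INR N) by field; lra.
  have := Rmult_le_compat_l (2 * (y + 1) + 1) _ _ ltac:(lra) iz.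
  by move: H sl => /Rabs_le_between H /Rabs_le_between sl ?; apply: Rabs_le; rewrite /Rdiv in H sl *; lra.
have B4 : Rabs (s / y * P - ln (INR N) * s / y) <= C0 / y.
  have -> : s / y * P - ln (INR N) * s / y = s * ((P - ln (INR N)) / y) by field; lra.
  rewrite Rabs_mult Rabs_div; last by lra.
  rewrite (Rabs_right y); last by lra.
  have c0 : 0 <= C0 by have := Rabs_pos (P - ln (INR N)); lra.
  have : Rabs s <= 1 by exact: Rabs_sin_le1.
  have : Rabs (P - ln (INR N)) / y <= C0 / y by apply: Rmult_le_compat_r; lra.
  have : 0 <= Rabs (P - ln (INR N)) / y by apply: Rdiv_le_0_compat => //; exact: Rabs_pos.
  move=> a b /(Rmult_le_compat_r (Rabs (P - ln (INR N)) / y) _ _ a); lra.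
move: H1 B2 B3 B4 => /Rabs_le_between H1 /Rabs_le_between B2 /Rabs_le_between B3 /Rabs_le_between B4.
by apply: Rabs_le; lra.
Qed.

Hypothesis Z1_gt0 : 0 < Z1.

(** Division by zeta: the phases $0$ and $\pi/2$ give two linear relations between the cosine and
    sine sums, invertible because $Z_1^2 + Z_2^2 > 0$. *)
Lemma prime_cos_sin : exists C, forall N, (0 < N)%N ->
  Rabs (\sum_(1 <= p < N.+1 | prime p) (ln (INR p) / INR p * cos (y * ln (INR p)))) <= C /\
  Rabs (\sum_(1 <= p < N.+1 | prime p) (ln (INR p) / INR p * sin (y * ln (INR p)))) <= C.
Proof.
have [C0 H0] := prime_osc 0; have [C1 H1] := prime_osc (PI / 2).
pose n2 := Z1 ^ 2 + Z2 ^ 2; have n2p : 0 < n2 by rewrite /n2; nra.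
pose C := (Rabs Z1 * C0 + Rabs Z2 * C1 + (Rabs Z2 * C0 + Rabs Z1 * C1)) / n2.
exists C => N N0; move: (H0 N N0) (H1 N N0).
set c := \sum_(_ <= _ < _ | _) (_ * cos _); set s := \sum_(_ <= _ < _ | _) (_ * sin _).
have -> : \sum_(1 <= p < N.+1 | prime p) (ln (INR p) / INR p *
   (Z1 * cos (y * ln (INR p) + 0) - Z2 * sin (y * ln (INR p) + 0))) = Z1 * c - Z2 * s.
  rewrite !big_distrr sumR_sub; apply: eq_bigr => p _ /=.
  by rewrite Rplus_0_r; ring.
have -> : \sum_(1 <= p < N.+1 | prime p) (ln (INR p) / INR p *
   (Z1 * cos (y * ln (INR p) + PI / 2) - Z2 * sin (y * ln (INR p) + PI / 2)))
   = - Z1 * s - Z2 * c.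
  rewrite !big_distrr sumR_sub; apply: eq_bigr => p _ /=.
  by rewrite cos_plus sin_plus cos_PI2 sin_PI2; ring.
set e0 := Z1 * c - Z2 * s; set e1 := - Z1 * s - Z2 * c => h0 h1.
have z1 := Rabs_pos Z1; have z2 := Rabs_pos Z2.
have p0 : 0 <= C0 by have := Rabs_pos e0; lra.
have p1 : 0 <= C1 by have := Rabs_pos e1; lra.
have q a b : 0 <= a -> 0 <= b -> 0 <= a * b by exact: Rmult_le_pos.
have comb a b : Rabs (a * e0 + b * e1) <= Rabs a * C0 + Rabs b * C1.
  apply: Rle_trans (Rabs_triang _ _) _; rewrite !Rabs_mult.
  have := Rmult_le_compat_l _ _ _ (Rabs_pos a) h0.
  have := Rmult_le_compat_l _ _ _ (Rabs_pos b) h1; lra.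
have ns u : Rabs (n2 * u) <= Rabs Z1 * C0 + Rabs Z2 * C1 + (Rabs Z2 * C0 + Rabs Z1 * C1) -> Rabs u <= C.
  rewrite Rabs_mult (Rabs_right n2); last by lra.
  by move=> H; rewrite /C; apply/Rle_div_r => //; lra.
have q1 := q _ _ z1 p0; have q2 := q _ _ z2 p1; have q3 := q _ _ z2 p0; have q4 := q _ _ z1 p1.
split; apply: ns.
  have -> : n2 * c = Z1 * e0 + (- Z2) * e1 by rewrite /n2 /e0 /e1; ring.
  by have := comb Z1 (- Z2); rewrite Rabs_Ropp; lra.
have -> : n2 * s = (- Z2) * e0 + (- Z1) * e1 by rewrite /n2 /e0 /e1; ring.
by have := comb (- Z2) (- Z1); rewrite !Rabs_Ropp; lra.
Qed.

End PrimeOscillation.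

Lemma mertens_trig (c0 a b : R) : exists C, forall N, (0 < N)%N ->
  Rabs (\sum_(1 <= p < N.+1 | prime p)
     ((c0 + (a * cos (2 * PI * ln (INR p)) + b * sin (2 * PI * ln (INR p)))) * ln (INR p) / INR p)
   - c0 * ln (INR N)) <= C.
Proof.
have y0 : 0 < 2 * PI by have := PI_RGT_0; lra.
have [Z1 [Z2 osc]] := osc_sum (2 * PI) y0.
have Z1p : 0 < Z1.
  apply: osc_sum_re_pos => N N0; have := osc 0 N N0.
  rewrite cos_0 sin_0 Rmult_0_r Rmult_1_r Rminus_0_r Rplus_0_r.
  by under eq_bigr => n _ do rewrite Rplus_0_r.
have [C HC] := prime_cos_sin (2 * PI) Z1 Z2 y0 osc Z1p.
have [C0 HC0] := mertens_first.
exists (Rabs c0 * C0 + Rabs a * C + Rabs b * C) => N N0.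
have [H1 H2] := HC N N0; have H3 := HC0 N N0.
set P := \sum_(_ <= _ < _ | _) _ in H3; set c := \sum_(_ <= _ < _ | _) _ in H1.
set s := \sum_(_ <= _ < _ | _) _ in H2.
have -> : \sum_(1 <= p < N.+1 | prime p)
     ((c0 + (a * cos (2 * PI * ln (INR p)) + b * sin (2 * PI * ln (INR p)))) * ln (INR p) / INR p)
   = c0 * P + (a * c + b * s).
  rewrite /P /c /s !big_distrr -!big_split; apply: eq_bigr => p _ /=.
  by rewrite /Rdiv; ring.
have -> : c0 * P + (a * c + b * s) - c0 * ln (INR N) = c0 * (P - ln (INR N)) + a * c + b * s by ring.
apply: Rle_trans (Rabs_triang _ _) _; rewrite Rabs_mult.
have := Rabs_triang (c0 * (P - ln (INR N))) (a * c); rewrite !Rabs_mult.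
have := Rmult_le_compat_l _ _ _ (Rabs_pos c0) H3.
have := Rmult_le_compat_l _ _ _ (Rabs_pos a) H1.
have := Rmult_le_compat_l _ _ _ (Rabs_pos b) H2; lra.
Qed.

(** * One-sided bounds on blocks *)

Arguments prime_pi : simpl never.

Lemma prime_piS (n : nat) : prime_pi n.+1 = (prime_pi n + prime n.+1)%N.
Proof. by rewrite /prime_pi -[n.+2]addn1 iotaD count_cat /= addn0. Qed.

Lemma prime_sum_abel (w : nat -> R) (N : nat) :
  \sum_(1 <= p < N.+1 | prime p) w p
  = INR (prime_pi N) * w N + \sum_(1 <= n < N) (INR (prime_pi n) * (w n - w n.+1)).
Proof.
elim: N => [|N IH]; first by rewrite !big_geq //= Rmult_0_l Rplus_0_r.
have [N0|N0] := posnP N.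
  by rewrite N0 big_mkcond big_nat1 big_geq //= Rmult_0_l Rplus_0_r.
rewrite big_mkcond big_nat_recr //= -big_mkcond IH [in RHS]big_nat_recr //= prime_piS (plus_INR (prime_pi N)).
by case: (prime _) => /=; ring.
Qed.

Lemma nceil_ex (x : R) : 0 <= x -> {n : nat | x <= INR n < x + 1}.
Proof.
move=> x0; have [n [n1 n2]] := nfloor_ex x x0.
have [E|E] := Req_EM_T (INR n) x; first by exists n; lra.
by exists n.+1; rewrite S_INR; lra.
Qed.

(** The least [n] with $\ln n - 1/2 \ge k$; hence [log_floor n] equals [k] exactly from
    [block_start k] up to, but excluding, [block_start k.+1]. *)
Definition block_start (k : nat) : nat :=
  sval (nceil_ex (exp (INR k + 1 / 2)) (Rlt_le _ _ (exp_pos _))).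

Lemma block_startP (k : nat) :
  exp (INR k + 1 / 2) <= INR (block_start k) < exp (INR k + 1 / 2) + 1.
Proof. by rewrite /block_start; case: (nceil_ex _ _). Qed.

Lemma leq_INR (m n : nat) : INR m <= INR n -> (m <= n)%N.
Proof. by move=> /INR_le; lia. Qed.

Lemma block_start_gt0 (k : nat) : (0 < block_start k)%N.
Proof.
rewrite lt0n; apply/eqP => E; have [H _] := block_startP k.
by rewrite E /= in H; have := exp_pos (INR k + 1 / 2); lra.
Qed.

Lemma block_start_mono (k m : nat) : (k <= m)%N -> (block_start k <= block_start m)%N.
Proof.
move=> km; have [H1 H2] := block_startP k; have [H3 H4] := block_startP m.
have : exp (INR k + 1 / 2) <= exp (INR m + 1 / 2).
  by have [/exp_increasing|->] := Rle_lt_or_eq_dec _ _ (Rplus_le_compat_r (1 / 2) _ _ (INR_leq _ _ km)); lra.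
move=> H; have : INR (block_start k) < INR (block_start m).+1 by rewrite S_INR; lra.
by move=> /INR_lt; lia.
Qed.

Lemma ln_block_start (k : nat) :
  INR k + 1 / 2 <= ln (INR (block_start k)) <= INR k + 1 / 2 + / exp (INR k + 1 / 2).
Proof.
have [H1 H2] := block_startP k; have E := exp_pos (INR k + 1 / 2); split.
  by rewrite -{1}(ln_exp (INR k + 1 / 2)); apply: ln_le.
rewrite -{1}(ln_exp (INR k + 1 / 2)); apply: Rle_trans (ln_succ_le _ E).
by apply: ln_le; lra.
Qed.

Lemma leq_block_start (k : nat) : (k <= block_start k)%N.
Proof.
apply: leq_INR; have [H _] := block_startP k.
by have := exp_ineq1_le (INR k + 1 / 2); lra.
Qed.

Lemma floorP (r : R) : IZR (floorR r) <= r < IZR (floorR r) + 1.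
Proof. by have := base_Int_part r; rewrite /floorR; lra. Qed.

Lemma floor_mono (r s : R) : r <= s -> (floorR r <= floorR s)%Z.
Proof.
move=> rs; have := floorP r; have := floorP s => H1 H2.
suff : (floorR r < floorR s + 1)%Z by lia.
by apply: lt_IZR; rewrite plus_IZR; lra.
Qed.

Definition log_floor (n : nat) : Z := floorR (ln (INR n) - 1 / 2).

Lemma log_floor_ge (k n : nat) : (block_start k <= n)%N -> INR k <= IZR (log_floor n).
Proof.
move=> H; have [L _] := ln_block_start k.
have := ln_le _ _ (INR_gt0 _ (block_start_gt0 k)) (INR_leq _ _ H) => L2.
have [_] := floorP (ln (INR n) - 1 / 2); rewrite -/(log_floor n) => F.
suff : (Z.of_nat k < log_floor n + 1)%Z.
  by rewrite INR_IZR_INZ => ?; apply: IZR_le; lia.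
by apply: lt_IZR; rewrite plus_IZR -INR_IZR_INZ; lra.
Qed.

Lemma log_floor_le (k n : nat) : (0 < n)%N -> (n < block_start k.+1)%N ->
  IZR (log_floor n) <= INR k.
Proof.
move=> n0 H; have [_ L] := block_startP k.+1.
have n1 := INR_gt0 _ n0.
have H1 : INR n < exp (INR k.+1 + 1 / 2).
  by have := INR_leq _ _ H; rewrite S_INR; lra.
have := ln_increasing _ _ n1 H1; rewrite ln_exp S_INR => L2.
have [F _] := floorP (ln (INR n) - 1 / 2); rewrite -/(log_floor n) in F.
suff : (log_floor n < Z.of_nat k + 1)%Z.
  by rewrite INR_IZR_INZ => ?; apply: IZR_le; lia.
by apply: lt_IZR; rewrite plus_IZR -INR_IZR_INZ; lra.
Qed.

(* [log_floor n * prime_pi n - n] decreases by at most one per step: once positive,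
   it stays positive unless it vanishes. *)
Lemma eventually_one_sided (n0 : nat) :
  (forall n, (n0 <= n)%N -> IZR (log_floor n) * INR (prime_pi n) <> INR n) ->
  exists n1, (forall n, (n1 <= n)%N -> IZR (log_floor n) * INR (prime_pi n) < INR n) \/
             (forall n, (n1 <= n)%N -> INR n < IZR (log_floor n) * INR (prime_pi n)).
Proof.
move=> ne.
(* From [block_start 0] on the floor is nonnegative and nondecreasing, so the product never
   falls. *)
have [[m [m0 Hm]]|no] := classic (exists n, (n0 + block_start 0 <= n)%N /\
    INR n < IZR (log_floor n) * INR (prime_pi n)).
  exists m; right; elim => [|n IH] H.
    by have -> : 0%N = m by lia.
  have [E|H'] := eqVneq m n.+1; first by rewrite -E.
  have {}IH := IH ltac:(lia); have := ne n.+1 ltac:(lia).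
  have F : (log_floor n <= log_floor n.+1)%Z.
    apply: floor_mono; have := block_start_gt0 0 => b0.
    have := ln_le (INR n) (INR n.+1) (INR_gt0 n ltac:(lia)) (INR_leq _ _ (leqnSn n)); lra.
  have F0 : (0 <= log_floor n.+1)%Z.
    by apply: le_IZR; apply: (log_floor_ge 0); lia.
  move: IH; rewrite prime_piS !INR_IZR_INZ -!mult_IZR => /lt_IZR IH ne'.
  have : (log_floor n.+1 * Z.of_nat (prime_pi n + prime n.+1)%N <> Z.of_nat n.+1)%Z.
    by move=> E; apply: ne'; rewrite E.
  by move=> ?; apply: IZR_lt; nia.
exists (n0 + block_start 0)%N; left => n Hn.
have [//|[E|H]] := Rtotal_order (IZR (log_floor n) * INR (prime_pi n)) (INR n).
  by case: (ne n) => //; lia.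
by case: no; exists n.
Qed.

Lemma harmonic_ge (K m : nat) : (0 < K)%N -> (K <= m)%N ->
  ln (INR m) - ln (INR K) <= \sum_(K <= k < m) / INR k.
Proof.
move=> K0 Km; rewrite -(sumR_telescope K m (fun k => ln (INR k))) //.
apply: sumR_le => k Hk _; have k0 := INR_gt0 k ltac:(lia).
by have := ln_succ_le _ k0; rewrite -S_INR; lra.
Qed.

Lemma harmonic_unbounded (K : nat) (B : R) : (0 < K)%N ->
  exists m, (K <= m)%N /\ B < \sum_(K <= k < m) / INR k.
Proof.
move=> K0; have [n [n1 _]] := nceil_ex (exp (B + ln (INR K) + 1)) (Rlt_le _ _ (exp_pos _)).
exists (n + K)%N; split; first by lia.
have := harmonic_ge K (n + K)%N K0 ltac:(lia).
have : ln (exp (B + ln (INR K) + 1)) <= ln (INR (n + K)%N).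
  apply: ln_le; first exact: exp_pos.
  by apply: Rle_trans n1 _; apply: INR_leq; lia.
rewrite ln_exp; lra.
Qed.

(** The factor $48 = 3 \cdot 16$ serves [H_block_start], where $3(t+1)e^{-t}$ must be at most
    $1/16$. *)
Lemma exp_ge_affine (t : R) : 200 <= t -> 48 * (t + 1) <= exp t.
Proof.
move=> t0; have -> : exp t = exp (t / 2) * exp (t / 2).
  by rewrite -exp_plus; congr exp; field.
have := exp_ineq1_le (t / 2) => H.
have : (1 + t / 2) * (1 + t / 2) <= exp (t / 2) * exp (t / 2) by apply: Rmult_le_compat; lra.
nra.
Qed.

(** * Testing one-sided bounds against a periodic weight *)

Section Weight.
Variable eps : R.
Hypothesis eps_bound : -1 <= eps <= 1.

Let q := / (1 + (2 * PI) ^ 2).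
Let a := - eps * (2 * PI) * q.
Let b := - eps * q.

(* [phi - phi' = psi := 2 - eps * sin (2 * PI * t)] is what makes [weight' x = - K (ln x) / x ^ 2]
   with the kernel [K t = t * psi t - phi t]; [H] is a primitive of [K]. *)
Definition phi t := 2 + (a * cos (2 * PI * t) + b * sin (2 * PI * t)).
Definition weight x := phi (ln x) * ln x / x.
Let K t := t * (2 - eps * sin (2 * PI * t)) - phi t.
Let H t := t ^ 2 - 2 * t
  + eps * (t * cos (2 * PI * t) / (2 * PI) - sin (2 * PI * t) / (2 * PI) ^ 2)
  - (a * sin (2 * PI * t) - b * cos (2 * PI * t)) / (2 * PI).

Let PI_pos := PI_RGT_0.

Lemma phi_bounds (t : R) : 0 <= phi t <= 4.
Proof.
have D : 0 < 1 + (2 * PI) ^ 2 by nra.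
have q0 : 0 < q by exact: Rinv_0_lt_compat.
have q1 : q * (1 + (2 * PI) ^ 2) = 1 by rewrite /q; field; lra.
have B1 : q <= 1 by nra.
(* From $(1 - 2\pi)^2 \ge 0$, that is $4\pi \le 1 + (2\pi)^2$. Thus $|a| + |b| \le 3/2$, which keeps
   [phi] within $[0,4]$. *)
have B2 : 2 * PI * q <= 1 / 2.
  by have := Rmult_le_pos _ _ (Rlt_le _ _ q0) (pow2_ge_0 (1 - 2 * PI)); lra.
have e : Rabs eps <= 1 by apply: Rabs_le; lra.
have := Rabs_comb_le a b _ _ (Rabs_cos_le1 (2 * PI * t)) (Rabs_sin_le1 (2 * PI * t)).
have -> : Rabs a = Rabs eps * (2 * PI * q).
  have -> : a = - (eps * (2 * PI * q)) by rewrite /a; ring.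
  by rewrite Rabs_Ropp Rabs_mult (Rabs_right (2 * PI * q)) //; nra.
have -> : Rabs b = Rabs eps * q.
  have -> : b = - (eps * q) by rewrite /b; ring.
  by rewrite Rabs_Ropp Rabs_mult (Rabs_right q) //; lra.
have := Rabs_pos eps => e0 /Rabs_le_between; rewrite /phi; nra.
Qed.

Lemma K_bounds (t : R) : 4 <= t -> 0 <= K t <= 3 * t.
Proof.
move=> t4; have := phi_bounds t; have [s1 s2] := SIN_bound (2 * PI * t).
have [e1 e2] : -1 <= eps * sin (2 * PI * t) <= 1 by nra.
rewrite /K; nra.
Qed.

Lemma derive_H (t : R) : is_derive H t (K t).
Proof.
rewrite /H; auto_derive => //; rewrite /K /phi.
by field; lra.
Qed.

Lemma derive_H_ln (x : R) : 0 < x -> is_derive (fun x => H (ln x)) x (K (ln x) / x).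
Proof.
move=> x0; have -> : K (ln x) / x = scal (/ x) (K (ln x)).
  by rewrite /scal /= /mult /= /Rdiv Rmult_comm.
apply: is_derive_comp; first exact: derive_H.
exact: is_derive_ln.
Qed.

Lemma derive_weight (x : R) : 0 < x -> is_derive weight x (- K (ln x) / x ^ 2).
Proof.
move=> x0; rewrite /weight /phi; auto_derive; first by lra.
have D : 0 < 1 + (2 * PI) ^ 2 by nra.
rewrite /K /phi /a /b /q; field; split; [lra|nra].
Qed.

Lemma weight_ge0 (x : R) : 1 <= x -> 0 <= weight x.
Proof.
move=> x1; have [p0 _] := phi_bounds (ln x); have := ln_ge0 x x1 => l0.
by apply: Rdiv_le_0_compat; [exact: Rmult_le_pos|lra].
Qed.

Let drop (n : nat) := weight (INR n) - weight (INR n.+1).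

(** [drop n] is the integral of $K(\ln x)/x^2$ over $[n,n+1]$ and the middle term that of $K(\ln
    x)/x$; the integrands differ by the factor $x$ between $n$ and $n+1$, and $K \ge 0$. *)
Lemma drop_bounds (n : nat) : (0 < n)%N -> 4 <= ln (INR n) ->
  INR n * drop n <= H (ln (INR n.+1)) - H (ln (INR n)) <= (INR n + 1) * drop n.
Proof.
move=> n0 n4; rewrite /drop S_INR; have := INR_gt0 _ n0; set c := INR n in n4 * => c0.
have Kx x : c <= x -> 0 <= K (ln x) / x ^ 2.
  move=> cx; have := ln_le _ _ c0 cx => L.
  have [k0 _] := K_bounds (ln x) ltac:(lra).
  by apply: Rdiv_le_0_compat => //; apply: pow_lt; lra.
split.
  suff : H (ln c) + c * weight c <= H (ln (c + 1)) + c * weight (c + 1) by lra.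
  apply: (incr_of_derive (fun x => H (ln x) + c * weight x)
    (fun x => K (ln x) / x + c * (- K (ln x) / x ^ 2))) => [|x Hx|x Hx]; first by lra.
    apply: (is_derive_plus (V := R_NormedModule)); first by apply: derive_H_ln; lra.
    by apply: is_derive_scal; apply: derive_weight; lra.
  have -> : K (ln x) / x + c * (- K (ln x) / x ^ 2) = K (ln x) / x ^ 2 * (x - c) by field; lra.
  by apply: Rmult_le_pos; [apply: Kx|]; lra.
suff : - (c + 1) * weight c - H (ln c) <= - (c + 1) * weight (c + 1) - H (ln (c + 1)) by lra.
apply: (incr_of_derive (fun x => - (c + 1) * weight x - H (ln x))
  (fun x => - (c + 1) * (- K (ln x) / x ^ 2) - K (ln x) / x)) => [|x Hx|x Hx]; first by lra.
  apply: (is_derive_minus (V := R_NormedModule)); last by apply: derive_H_ln; lra.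
  by apply: is_derive_scal; apply: derive_weight; lra.
have -> : - (c + 1) * (- K (ln x) / x ^ 2) - K (ln x) / x = K (ln x) / x ^ 2 * (c + 1 - x) by field; lra.
by apply: Rmult_le_pos; [apply: Kx|]; lra.
Qed.

Lemma drop_ge0 (n : nat) : (0 < n)%N -> 4 <= ln (INR n) -> 0 <= drop n.
Proof. by move=> n0 n4; have := drop_bounds n n0 n4; lra. Qed.

(** The source of the bias: at half-integers the cosine is $-1$ and the sine 0, so of the periodic
    terms only $t\cos(2\pi t)/(2\pi)$ changes. *)
Lemma H_step (k : nat) : H (INR k + 3 / 2) - H (INR k + 1 / 2) = 2 * INR k - eps / (2 * PI).
Proof.
have C j : cos (2 * PI * (INR j + 1 / 2)) = -1.
  have -> : 2 * PI * (INR j + 1 / 2) = PI + 2 * INR j * PI by field.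
  by rewrite cos_period cos_PI.
have S j : sin (2 * PI * (INR j + 1 / 2)) = 0.
  have -> : 2 * PI * (INR j + 1 / 2) = PI + 2 * INR j * PI by field.
  by rewrite sin_period sin_PI.
have -> : INR k + 3 / 2 = INR k.+1 + 1 / 2 by rewrite S_INR; lra.
by rewrite /H !C !S S_INR; field; lra.
Qed.

(** Rounding the block ends up to integers moves $t$ by at most $e^{-t}$, where $K \le 3(t+1)$. The
    allowance $1/16$ is half of $1/8 \le 1/(2\pi)$, so the bias survives. *)
Lemma H_block_start (k : nat) : (200 <= k)%N ->
  0 <= H (ln (INR (block_start k))) - H (INR k + 1 / 2) <= 1 / 16.
Proof.
move=> k0; have := INR_leq _ _ k0.
have -> : INR 200 = 200 by rewrite INR_IZR_INZ.
move=> k1; have [L1 L2] := ln_block_start k.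
have := exp_ge_affine (INR k + 1 / 2) ltac:(lra).
set t := INR k + 1 / 2 in L1 L2 *; set u := ln (INR (block_start k)) in L1 L2 *.
move=> E; have e0 := exp_pos t.
have i1 : / exp t <= 1 by rewrite -Rinv_1; apply: Rinv_le_contravar; rewrite /t in E *; lra.
have t2 : 200 <= t by rewrite /t; lra.
split.
  have : H t <= H u; last by lra.
  apply: (incr_of_derive H K) => // x Hx; first exact: derive_H.
  by have [] := K_bounds x ltac:(lra).
have : Rabs (H u - H t) <= 3 * (t + 1) * u - 3 * (t + 1) * t.
  apply: (derive_dominated H K (fun x => 3 * (t + 1) * x) (fun=> 3 * (t + 1))) => // x Hx.
  - exact: derive_H.
  - by auto_derive => //; ring.
  - by have [? ?] := K_bounds x ltac:(lra); rewrite Rabs_right; lra.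
have : 3 * (t + 1) * (u - t) <= 3 * (t + 1) * / exp t by apply: Rmult_le_compat_l; lra.
have : 3 * (t + 1) * / exp t <= 1 / 16 by apply/Rle_div_l; lra.
have := Rle_abs (H u - H t); lra.
Qed.

Lemma block_n_ge (k n : nat) : (200 <= k)%N -> (block_start k <= n)%N ->
  (0 < n)%N /\ 4 <= ln (INR n).
Proof.
move=> k0 kn; have b0 := block_start_gt0 k; split; first by lia.
have [L _] := ln_block_start k.
have := ln_le _ _ (INR_gt0 _ b0) (INR_leq _ _ kn); have := INR_leq _ _ k0.
have -> : INR 200 = 200 by rewrite INR_IZR_INZ.
lra.
Qed.

Lemma block_telescope (k : nat) : (200 <= k)%N ->
  2 * INR k - eps / (2 * PI) - 1 / 16 <=
  \sum_(block_start k <= n < block_start k.+1) (H (ln (INR n.+1)) - H (ln (INR n)))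
  <= 2 * INR k - eps / (2 * PI) + 1 / 16.
Proof.
move=> k0.
rewrite (sumR_telescope _ _ (fun n => H (ln (INR n)))); last exact: block_start_mono.
have := H_block_start k k0; have := H_block_start k.+1 ltac:(lia); have := H_step k.
have -> : INR k.+1 + 1 / 2 = INR k + 3 / 2 by rewrite S_INR; lra.
lra.
Qed.

Lemma weight_sum : exists C, forall N, (0 < N)%N ->
  Rabs (INR (prime_pi N) * weight (INR N)
        + \sum_(1 <= n < N) (INR (prime_pi n) * drop n) - 2 * ln (INR N)) <= C.
Proof.
have [C HC] := mertens_trig 2 a b; exists C => N N0.
by rewrite -(prime_sum_abel (fun n => weight (INR n))); apply: HC.
Qed.

Let S m := \sum_(1 <= n < block_start m) (INR (prime_pi n) * drop n).

Lemma S_succ (m : nat) :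
  S m.+1 = S m + \sum_(block_start m <= n < block_start m.+1) (INR (prime_pi n) * drop n).
Proof.
rewrite /S (big_cat_nat (n := block_start m)) //=; first exact: block_start_gt0.
exact: block_start_mono.
Qed.

(** With $\pi(n) \le n/k$ the $k$-th block contributes at most $2 - 1/(16k)$, while [weight_sum]
    forces $2m + O(1)$ up to [block_start m]; the harmonic deficit is unbounded. *)
Lemma not_eventually_below (n1 : nat) : eps = 1 ->
  ~ (forall n, (n1 <= n)%N -> IZR (log_floor n) * INR (prime_pi n) < INR n).
Proof.
move=> E below.
have P4 := PI_4; have PI8 : 1 / 8 <= eps / (2 * PI) 
  by rewrite E; have := Rinv_le_contravar (2 * PI) 8 ltac:(lra) ltac:(lra); lra.
pose k0 := (200 + n1)%N.
have piB k n : (k0 <= k)%N -> (block_start k <= n)%N -> INR k * INR (prime_pi n) <= INR n.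
  move=> Hk Hn; have F := log_floor_ge k n Hn.
  have := below n ltac:(have := leq_block_start k; lia).
  by have := Rmult_le_compat_r _ _ _ (pos_INR (prime_pi n)) F; lra.
have block k : (k0 <= k)%N ->
  \sum_(block_start k <= n < block_start k.+1) (INR (prime_pi n) * drop n) <= 2 - / 16 * / INR k.
  move=> Hk; have k1 := INR_gt0 k ltac:(lia); apply: (Rmult_le_reg_l (INR k)) => //.
  have -> : INR k * (2 - / 16 * / INR k) = 2 * INR k - / 16 by field; lra.
  apply: Rle_trans (_ : 2 * INR k - eps / (2 * PI) + 1 / 16 <= _); last by lra.
  have [_ T] := block_telescope k ltac:(lia); apply: Rle_trans T.
  rewrite big_distrr; apply: sumR_le => n Hn _ /=.
  have [n0 n4] := block_n_ge k n ltac:(lia) ltac:(lia).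
  have [D _] := drop_bounds n n0 n4; have d0 := drop_ge0 n n0 n4.
  apply: Rle_trans D; rewrite -Rmult_assoc; apply: Rmult_le_compat_r => //.
  by apply: piB => //; lia.
have sumS m : (k0 <= m)%N ->
  S m <= S k0 + 2 * (INR m - INR k0) - / 16 * \sum_(k0 <= k < m) / INR k.
  elim: m => [|m IH] Hm; first by lia.
  have [H'|H'] := leqP k0 m; last first.
    have -> : m.+1 = k0 by lia.
    by rewrite big_geq //; lra.
  by rewrite S_succ big_nat_recr // S_INR; have := block m H'; have := IH H'; rewrite /=; lra.
have [C HC] := weight_sum.
have [m [Hm]] := harmonic_unbounded k0 (16 * (C + 10 + S k0 - 2 * INR k0)) ltac:(lia).
have := sumS m Hm; have := HC _ (block_start_gt0 m); rewrite -/(S m).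
have [L1 L2] := ln_block_start m.
have m1 := INR_ge1 m ltac:(lia).
have e1 : / exp (INR m + 1 / 2) <= 1.
  rewrite -[X in _ <= X]Rinv_1; apply: Rinv_le_contravar; first by lra.
  by have := exp_ineq1_le (INR m + 1 / 2); lra.
(* The boundary term of the Abel summation is at most $4(m + 3/2)/m \le 10$. *)
have : INR (prime_pi (block_start m)) * weight (INR (block_start m)) <= 10.
  have := piB m _ Hm (leqnn _); set N := INR (block_start m) in L1 L2 *.
  have N0 : 0 < N by exact/INR_gt0/block_start_gt0.
  set p := INR (prime_pi _) => B.
  have [p0 p4] := phi_bounds (ln N).
  have -> : p * weight N = (p / N) * (phi (ln N) * ln N) by rewrite /weight; field; lra.
  have B1 : 0 <= p / N <= / INR m.
    split; first by apply: Rdiv_le_0_compat => //; exact: pos_INR.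
    apply/Rle_div_l => //; apply: (Rmult_le_reg_l (INR m)); first by lra.
    by rewrite -Rmult_assoc Rinv_r; lra.
  have B2 : 0 <= phi (ln N) * ln N <= 4 * (INR m + 3 / 2) by split; nra.
  apply: Rle_trans (Rmult_le_compat _ _ _ _ (proj1 B1) (proj1 B2) (proj2 B1) (proj2 B2)) _.
  by apply: (Rmult_le_reg_l (INR m)); [lra|rewrite -Rmult_assoc Rinv_r; lra].
by move=> ? /Rabs_le_between; lra.
Qed.

Lemma not_eventually_above (n1 : nat) : eps = -1 ->
  ~ (forall n, (n1 <= n)%N -> INR n < IZR (log_floor n) * INR (prime_pi n)).
Proof.
move=> E above.
have P4 := PI_4; have PI8 : 1 / 8 <= - eps / (2 * PI) 
  by rewrite E; have := Rinv_le_contravar (2 * PI) 8 ltac:(lra) ltac:(lra); lra.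
pose k0 := (200 + n1)%N.
have block k : (k0 <= k)%N ->
  2 + / 16 * / INR k - (weight (INR (block_start k)) - weight (INR (block_start k.+1)))
  <= \sum_(block_start k <= n < block_start k.+1) (INR (prime_pi n) * drop n).
  move=> Hk; have k1 := INR_ge1 k ltac:(lia); apply: (Rmult_le_reg_l (INR k)); first by lra.
  (* The upper bound in [drop_bounds] has $n+1$ where the hypothesis gives only $n$. The excess is
     one [drop] per $n$, and it telescopes over all blocks to a bounded loss. *)
  have Wtel : weight (INR (block_start k)) - weight (INR (block_start k.+1))
    = \sum_(block_start k <= n < block_start k.+1) drop n.
    have := sumR_telescope _ _ (fun n => - weight (INR n)) (block_start_mono _ _ (leqnSn k)).
    have -> : \sum_(block_start k <= n < block_start k.+1) drop n
      = \sum_(block_start k <= i < block_start k.+1) (- weight (INR i.+1) - - weight (INR i)).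
      by apply: eq_bigr => n _; rewrite /drop; lra.
    lra.
  have W0 : 0 <= weight (INR (block_start k)) - weight (INR (block_start k.+1)).
    rewrite Wtel; apply: sumR_ge0 => n Hn _.
    by have [n0 n4] := block_n_ge k n ltac:(lia) ltac:(lia); exact: drop_ge0.
  set W := weight _ - weight _ in Wtel W0 *.
  have -> : INR k * (2 + / 16 * / INR k - W) = 2 * INR k + / 16 - INR k * W by field; lra.
  have [T _] := block_telescope k ltac:(lia).
  have kW := Rmult_le_compat_r _ _ _ W0 k1.
  suff : \sum_(block_start k <= n < block_start k.+1) (H (ln (INR n.+1)) - H (ln (INR n))) - W
    <= INR k * \sum_(block_start k <= n < block_start k.+1) (INR (prime_pi n) * drop n) by lra.
  rewrite Wtel sumR_sub big_distrr; apply: sumR_le => n Hn _ /=; rewrite -/(INR n.+1).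
  have [n0 n4] := block_n_ge k n ltac:(lia) ltac:(lia).
  have [_ D] := drop_bounds n n0 n4; have d0 := drop_ge0 n n0 n4.
  have B : INR n <= INR k * INR (prime_pi n).
    have := above n ltac:(have := leq_block_start k; lia).
    have F := log_floor_le k n n0 ltac:(lia).
    by have := Rmult_le_compat_r _ _ _ (pos_INR (prime_pi n)) F; lra.
  by have := Rmult_le_compat_r _ _ _ d0 B; lra.
have sumS m : (k0 <= m)%N ->
  S k0 + 2 * (INR m - INR k0) + / 16 * \sum_(k0 <= k < m) / INR k
    - (weight (INR (block_start k0)) - weight (INR (block_start m))) <= S m.
  elim: m => [|m IH] Hm; first by lia.
  have [H'|H'] := leqP k0 m; last first.
    have -> : m.+1 = k0 by lia.
    by rewrite big_geq //; lra.
  by rewrite S_succ big_nat_recr // S_INR; have := block m H'; have := IH H'; rewrite /=; lra.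
have [C HC] := weight_sum.
have [m [Hm]] := harmonic_unbounded k0
  (16 * (C + 3 - S k0 + 2 * INR k0 + weight (INR (block_start k0)))) ltac:(lia).
have := sumS m Hm; have := HC _ (block_start_gt0 m); rewrite -/(S m).
have [L1 L2] := ln_block_start m.
have e1 : / exp (INR m + 1 / 2) <= 1.
  rewrite -[X in _ <= X]Rinv_1; apply: Rinv_le_contravar; first by lra.
  by have := exp_ineq1_le (INR m + 1 / 2); have := pos_INR m; lra.
have w0 := weight_ge0 _ (INR_ge1 _ (block_start_gt0 m)).
have := Rmult_le_pos _ _ (pos_INR (prime_pi (block_start m))) w0.
by move=> ? /Rabs_le_between; lra.
Qed.

End Weight.

Theorem theorem3p1 :
  forall N : nat, exists n : nat, leq N n /\
    floorR (ln (INR n) - 1 / 2) <> 0%Z /\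
    INR (prime_pi n) = INR n / IZR (floorR (ln (INR n) - 1 / 2)).
Proof.
move=> N; apply: NNPP => no.
(* From [block_start 1] on the floor is at least 1, so the product equation may be divided by it. *)
have [n NE|n1 [below|above]] := eventually_one_sided (N + block_start 1)%N.
- move=> E; apply: no; exists n; split; first by lia.
  have F : 1 <= IZR (log_floor n) by apply: (log_floor_ge 1); lia.
  split; first by rewrite -/(log_floor n) => Z; rewrite Z in F; lra.
  by rewrite -/(log_floor n) -E; field; lra.
- exact: (not_eventually_below 1 ltac:(lra) n1 erefl).
- exact: (not_eventually_above (-1) ltac:(lra) n1 erefl).
Qed.
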